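(* Let $r\in\{1,2\}$. For each $\boldsymbol\theta\in(0,1)^r$ let $\Delta(\boldsymbol\theta)\subset\Delta$ be a class of sequential procedures and let $\delta_0(\boldsymbol\theta)=(T_0(\boldsymbol\theta),D_0(\boldsymbol\theta))\in\Delta(\boldsymbol\theta)$. Assume that for each $k\in[K]$ and $(i,i')\in\{(0,1),(1,0)\}$, $\int \log(f_i^k/f_{i'}^k) f_i^k\,d\mu^k>0$ and $\int[\log(f_i^k/f_{i'}^k)]^2 f_i^k\,d\mu^k<\infty$. Assume that there exist a cost $c_{\boldsymbol\theta}>0$ for each $\boldsymbol\theta\in(0,1)^r$, a loss function $\mathcal W:\mathcal A\times\mathcal A\to[0,\infty)$ and a constant $L>0$ such that: (i) $\max_{A\in\mathcal A}\mathcal W(D\mid A)>0$ for each $D\in\mathcal A$; (ii) $T_0(\boldsymbol\theta)\le T_{\mathrm{Ld}}(c_{\boldsymbol\theta},\mathcal W)$ $\mathbb P_A$-almost surely, for each $A\in\mathcal A$ and $\boldsymbol\theta\in(0,1)^r$; (iii) $\mathrm{ERR}^{\mathrm{int}}(\delta;\mathcal W)\le L c_{\boldsymbol\theta}$ for every procedure $\delta\in\Delta(\boldsymbol\theta)$ and each $\boldsymbol\theta\in(0,1)^r$. Then there exists a constant $M>0$, depending only on $\mathcal W$ and not on $\boldsymbol\theta$, such that $$\mathbb E_A[T_0(\boldsymbol\theta)]-T_A^{\min}(\Delta(\boldsymbol\theta))\le (2L+M)\,|\mathcal A|\qquad\text{for each }A\in\mathcal A\text{ and }\boldsymbol\thet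a\in(0,1)^r.$$
   Context: The following model is fixed throughout. $K\ge2$, $[K]=\{1,\dots,K\}$. For each $k\in[K]$, $\mu^k$ is a $\sigma$-finite measure on a measurable space $\mathcal X^k$ and $f_0^k,f_1^k$ are probability densities with respect to $\mu^k$. One observes $K$ independent streams $\{\mathbf X_t^k:t\ge1\}$, each i.i.d. For $A\subset[K]$ (the signal subset), $\mathbb P_A$ (expectation $\mathbb E_A$) is the law under which the streams are independent and stream $k$ is i.i.d. with density $f_1^k$ if $k\in A$ and $f_0^k$ if $k\notin A$. Write $\mathbf X_t^{[K]}=(\mathbf X_t^1,\dots,\mathbf X_t^K)$, $\mathcal F_t=\sigma(\mathbf X_1^{[K]},\dots,\mathbf X_t^{[K]})$, and $f_A(x^1,\dots,x^K)=\prod_{i\in A}f_1^i(x^i)\prod_{j\in A^c}f_0^j(x^j)$. $\mathcal A\subset 2^{[K]}$ is the collection of all possible signal subsets. A sequential procedure is a pair $\delta=(T,D)$ with $T$ an $\{\mathcal F_t\}_{t\ge1}$-stopping time and $D$ an $\mathcal F_T$-measurable decision with values in $\mathcal A$; $\Delta$ is the class of all such procedures. For $\Delta'\subset\Delta$, $T_A^{\min}(\Delta'):=\inf_{(T,D)\in\Delta'}\mathbb E_A[T]$. A loss function is a map $\mathcal W(\cdot\mid\cdot):\mathcal A\times\mathcal A\to[0,\infty)$, where $\mathcal W(D\mid A)$ is the loss of deciding $D$ when the truth is $A$; it is always assumed that $\mathcal W(A\mid A)=0$ for all $A\in\mathcal A$. Let $\pi_0$ be the uniform distribution on $\mathcal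 A$. The integrated error loss of $\delta=(T,D)$ is $\mathrm{ERR}^{\mathrm{int}}(\delta;\mathcal W)=\sum_{A\in\mathcal A}\pi_0(A)\sum_{d\in\mathcal A}\mathbb P_A(D=d)\mathcal W(d\mid A)$. With $f_{A,[t]}=\prod_{s=1}^t f_A(\mathbf X_s^{[K]})$ and posterior $\pi_t(A)=f_{A,[t]}/\sum_{B\in\mathcal A}f_{B,[t]}$, for $c>0$ define $$T_{\mathrm{Ld}}(c,\mathcal W)=\min\Bigl\{t\ge1:\min_{D\in\mathcal A}\sum_{A\in\mathcal A}\pi_t(A)\mathcal W(D\mid A)<c\Bigr\}.$$ *)

(* Defs.v *)
From HB Require Import structures.
From mathcomp Require Import all_boot all_order all_algebra finmap.
From mathcomp Require Import all_classical all_reals all_analysis.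

Set Implicit Arguments.
Unset Strict Implicit.
Unset Printing Implicit Defensive.

Import Order.TTheory GRing.Theory Num.Theory.
Import numFieldNormedType.Exports.

Local Open Scope classical_set_scope.
Local Open Scope ring_scope.
Local Open Scope ereal_scope.

Definition mutually_independent {R : realType} {dO : measure_display}
    {Omega : measurableType dO} (P : probability Omega R)
    {I : choiceType} {d : I -> measure_display}
    {E : forall i, measurableType (d i)} (Y : forall i, Omega -> E i) : Prop :=
  forall (J : {fset I}) (B : forall i, set (E i)),
    (forall i, i \in J -> measurable (B i)) ->
    P (\bigcap_(i in [set` J]) (Y i @^-1` B i)) =
    \prod_(i <- J) P (Y i @^-1` B i).

Definition is_density {R : realType} {d : measure_display}
    {T : measurableType d} (mu : {measure set T -> \bar R}) (g : T -> R) : Prop :=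
  [/\ measurable_fun setT g, (forall x, (0 <= g x)%R) &
      \int[mu]_x (g x)%:E = 1].

(* The log-ratio is taken in \bar R: where g vanishes and h does not,
   lne (h / g) = +oo, whereas the real-valued ln (h / g) would be 0 there.
   Where h vanishes, the product with h is 0 in both integrands below. *)
Definition log_ratio {R : realType} {T : Type} (h g : T -> R) (x : T) : \bar R :=
  lne ((h x)%:E / (g x)%:E).

Definition log_ratio_mean {R : realType} {d : measure_display}
    {T : measurableType d} (mu : {measure set T -> \bar R}) (h g : T -> R) : \bar R :=
  \int[mu]_x (log_ratio h g x * (h x)%:E).

Definition log_ratio_moment2 {R : realType} {d : measure_display}
    {T : measurableType d} (mu : {measure set T -> \bar R}) (h g : T -> R) : \bar R :=
  \int[mu]_x (log_ratio h g x ^+ 2 * (h x)%:E).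

(* Streams are stored from index 0: [xi k s] is the observation of stream k at
   time s + 1, so the observations up to time t are the [xi k s] with s < t.
   [f false k] and [f true k] are the null and the signal density of stream k. *)
Section Streams.
Context {R : realType} {K : nat}.
Context {dX : 'I_K -> measure_display} {X : forall k, measurableType (dX k)}.
Context {dO : measure_display} {Omega : measurableType dO}.

Definition stream_law (mu : forall k, {sigma_finite_measure set (X k) -> \bar R})
    (f : bool -> forall k, X k -> R) (xi : forall k, nat -> Omega -> X k)
    (A : {set 'I_K}) (P : probability Omega R) : Prop :=
  (forall k s (B : set (X k)), measurable B ->
     P (xi k s @^-1` B) = \int[mu k]_(x in B) (f (k \in A) k x)%:E) /\
  mutually_independent P
    (fun p : 'I_K * nat => xi p.1 p.2 : Omega -> X p.1).

Definition joint_density (f : bool -> forall k, X k -> R) (A : {set 'I_K})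
    (x : forall k, X k) : R :=
  ((\prod_(i in A) f true i (x i)) * (\prod_(j in ~: A) f false j (x j)))%R.

Variable xi : forall k : 'I_K, nat -> Omega -> X k.

Definition filtration (t : nat) : set_system Omega :=
  <<s \bigcup_(k in [set: 'I_K]) \bigcup_(s in `I_t)
        preimage_set_system setT (xi k s) measurable >>.

Definition is_stopping_time (T : Omega -> \bar R) : Prop :=
  (forall w, T w = +oo \/ exists2 t : nat, (1 <= t)%N & T w = t%:R%:E) /\
  (forall t : nat, (1 <= t)%N -> filtration t [set w | T w <= t%:R%:E]).

Definition stopped_sigma_algebra (T : Omega -> \bar R) : set_system Omega :=
  [set B | measurable B /\ forall t : nat, (1 <= t)%N ->
             filtration t (B `&` [set w | T w <= t%:R%:E])].

Variable calA : {set {set 'I_K}}.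

Definition procedure : Type :=
  ((Omega -> \bar R) * (Omega -> {set 'I_K}))%type.

Definition procedures : set procedure :=
  [set delta | [/\ is_stopping_time delta.1,
     (forall w, delta.2 w \in calA) &
     (forall E : set {set 'I_K},
        stopped_sigma_algebra delta.1 (delta.2 @^-1` E))]].

Definition expected_time (P : probability Omega R) (T : Omega -> \bar R) : \bar R :=
  \int[P]_w T w.

Definition Tmin (P : probability Omega R) (Delta : set procedure) : \bar R :=
  ereal_inf [set expected_time P delta.1 | delta in Delta].

(* [W d A] is the loss of deciding d when the truth is A; only its values for
   d and A in calA are used. *)
Variable W : {set 'I_K} -> {set 'I_K} -> R.

Definition is_loss : Prop :=
  (forall d A, d \in calA -> A \in calA -> (0 <= W d A)%R) /\
  (forall A, A \in calA -> W A A = 0%R).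

Definition ERRint (P : {set 'I_K} -> probability Omega R) (delta : procedure) :
    \bar R :=
  \sum_(A in calA) ((#|calA|%:R^-1)%:E *
    \sum_(d in calA) (P A (delta.2 @^-1` [set d]) * (W d A)%:E)).

Definition likelihood (f : bool -> forall k, X k -> R) (A : {set 'I_K})
    (t : nat) (w : Omega) : R :=
  (\prod_(s < t) joint_density f A (fun k => xi k s w))%R.

(* All likelihoods vanish simultaneously only on a set that is null under
   every P_A, A in calA; the quotient is then 0 by convention. *)
Definition posterior (f : bool -> forall k, X k -> R) (t : nat) (A : {set 'I_K})
    (w : Omega) : R :=
  (likelihood f A t w / \sum_(B in calA) likelihood f B t w)%R.

Definition posterior_loss (f : bool -> forall k, X k -> R) (t : nat)
    (d : {set 'I_K}) (w : Omega) : R :=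
  (\sum_(A in calA) posterior f t A w * W d A)%R.

(* The infimum is a minimum, or +oo if no such t exists. *)
Definition T_Ld (f : bool -> forall k, X k -> R) (c : R) (w : Omega) : \bar R :=
  ereal_inf [set t%:R%:E | t in [set t : nat | (1 <= t)%N /\
    \big[mine/+oo]_(d in calA) (posterior_loss f t d w)%:E < c%:E]].

End Streams.

Definition open_unit_cube {R : realType} (r : nat) : set 'rV[R]_r :=
  [set theta | forall i, (0 < theta 0%R i < 1)%R].
Arguments open_unit_cube {R} r.

(* Main.v *)
Require Import Defs.
From HB Require Import structures.
From mathcomp Require Import all_boot all_order all_algebra finmap.
From mathcomp Require Import all_classical all_reals all_analysis.
From mathcomp Require Import measurable_realfun.
From mathcomp Require Import ring lra.

Set Implicit Arguments.
Unset Strict Implicit.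
Unset Printing Implicit Defensive.

Import Order.TTheory GRing.Theory Num.Theory.
Import numFieldNormedType.Exports.

Local Open Scope classical_set_scope.
Local Open Scope ring_scope.
Local Open Scope ereal_scope.

(** Fix a truth A and a competing procedure (T, D), and write n for the number
    of hypotheses and c for the cost.  It suffices to bound the mean under A of
    the time that elapses between T and T_Ld when T comes first, because the
    procedure under study stops no later than T_Ld.

    Condition on the event E = {T = s, D = d}, which the observations up to time
    s determine.  Let d' be d if d is correct under A (zero loss), and A itself
    otherwise; either way d' has zero loss under A ([fallback]).  If T_Ld has not
    occurred by time s + t, then d' still has posterior loss at least c, so some
    B satisfies f_A <= kap f_B at time s + t, where kap = n W(d'|B) / c
    ([T_Ld_le]).  By Markov's inequality under P_A the probability of E and this
    event is at most sqrt kap times the integral over E of sqrt (f_B / f_A) at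
    time s + t.  The t observations made after s are independent of E, and each
    contributes a factor equal to the Hellinger affinity of f_A and f_B
    ([sqrt_ratio_decay]); this factor is below 1 since equal densities would
    have zero mean log-ratio ([total_affinity_lt1]).  What remains is an integral
    over E at time s, and sqrt kap x <= b / 2 + kap x^2 / (2 b) together with the
    change of measure from A to B ([change_of_measure]) bounds it by
    b / 2 P_A(E) + kap / (2 b) P_B(E) ([not_dominating_tail]).

    The choice of b decides which loss of (T, D) pays for the factor 1 / c.  If
    d is correct under A, then d' = d and kap P_B(E) is the loss of d under B; if
    not, the loss of d under A is bounded below and pays instead.  In both cases
    the bound is a geometric factor rho ^ t times a small multiple eta of
    the losses on E over c plus a constant multiple of P_A(E) + P_B(E)
    ([unresolved_prob]).  Summing over t, s, d and B reconstitutes the integrated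
    error of (T, D), which is at most L c; the cost c cancels, and eta is chosen
    so that the first part is 2 L n ([integral_excess_le]).  The constant M is
    what the second part gives, and it involves neither c nor the procedures. *)

(** * Measures with a density, and independence *)

Section DensityMeasure.
Context {R : realType} {d : measure_display} {T : measurableType d}.
Variables (m : {measure set T -> \bar R}) (h : T -> R).
Hypotheses (h0 : forall x, (0 <= h x)%R) (mh : measurable_fun setT h).

(** The hypotheses on h are arguments so that the measure structure attaches to
    this function. *)
Definition density_measure of (forall x, (0 <= h x)%R) & measurable_fun setT h :=
  fun B : set T => \int[m]_(x in B) (h x)%:E.

Local Notation nu := (density_measure h0 mh).

Let nu_set0 : nu set0 = 0. Proof. exact: integral_set0. Qed.

Let nu_ge0 B : 0 <= nu B.
Proof. by apply: integral_ge0 => x _; rewrite lee_fin. Qed.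

Let nu_sigma_additive : semi_sigma_additive nu.
Proof.
apply: semi_sigma_additive_nng_induced; first exact/measurable_EFinP.
by move=> x; rewrite lee_fin.
Qed.

HB.instance Definition _ :=
  isMeasure.Build _ _ _ nu nu_set0 nu_ge0 nu_sigma_additive.

Import HBNNSimple.

Lemma integral_density_measure (u : T -> \bar R) :
  (forall x, 0 <= u x) -> measurable_fun setT u ->
  \int[nu]_x u x = \int[m]_x (u x * (h x)%:E).
Proof.
move=> u0 mu'.
pose a := nnsfun_approx measurableT mu'.
have ua x : u x = lim ((a n x)%:E @[n --> \oo]).
  by apply/esym/cvg_lim => //; exact: cvg_nnsfun_approx.
have uha x : u x * (h x)%:E = lim ((a n x)%:E * (h x)%:E @[n --> \oo]).
  apply/esym/cvg_lim => //; apply: cvgeZr => //.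
  exact: cvg_nnsfun_approx.
transitivity (\int[nu]_x lim ((a n x)%:E @[n --> \oo])).
  by apply: eq_integral => x _.
transitivity (\int[m]_x lim ((a n x)%:E * (h x)%:E @[n --> \oo])); last first.
  by apply: eq_integral => x _; rewrite uha.
rewrite !monotone_convergence//; last 6 first.
- move=> n; apply/measurable_EFinP; exact: measurable_funM.
- by move=> n x _; rewrite -EFinM lee_fin mulr_ge0.
- move=> x _ i j ij; rewrite -!EFinM lee_fin ler_wpM2r//.
  exact/lefP/nd_nnsfun_approx.
- by move=> n; apply/measurable_EFinP.
- by move=> n x _; rewrite lee_fin.
- move=> x _ i j ij; rewrite lee_fin; exact/lefP/nd_nnsfun_approx.
suff suf n : \int[nu]_x (a n x)%:E = \int[m]_x ((a n x)%:E * (h x)%:E).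
  by under eq_fun do rewrite suf.
transitivity (\sum_(y \in range (a n)) y%:E * nu (a n @^-1` [set y])).
  by rewrite integralT_nnsfun sintegralE.
have mah y : measurable_fun setT (fun x => (\1_(a n @^-1` [set y]) x * h x)%:E).
  apply/measurable_EFinP; exact: measurable_funM.
have ah0 y x : 0 <= (\1_(a n @^-1` [set y]) x * h x)%:E.
  by rewrite lee_fin mulr_ge0.
transitivity (\int[m]_x (\sum_(y \in range (a n))
    (y%:E * (\1_(a n @^-1` [set y]) x * h x)%:E))); last first.
  apply: eq_integral => x _; rewrite fimfunE -fsumEFin// ge0_mule_fsuml.
    by apply: eq_fsbigr => y _; rewrite -!EFinM mulrA.
  by move=> y; exact: nnfun_muleindic_ge0.
rewrite ge0_integral_fsum//; last 2 first.
- by move=> y; exact: measurable_funeM.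
- move=> y x _; rewrite EFinM muleA; apply: mule_ge0; last by rewrite lee_fin.
  exact: nnfun_muleindic_ge0.
apply: eq_fsbigr => y; rewrite inE => -[z _ <-].
rewrite ge0_integralZl//; last by rewrite lee_fin.
congr (_ * _).
rewrite /nu integral_mkcond; apply: eq_integral => x _.
by rewrite EFinM muleC epatch_indic.
Qed.

End DensityMeasure.

(** Two weighted push-forwards that agree on sets agree on functions.  It serves
    both to replace the law of an observation by its density and to split off one
    independent factor from a product. *)
Lemma integral_transfer {R : realType} {d1 d2 d : measure_display}
    {T1 : measurableType d1} {T2 : measurableType d2} {S : measurableType d}
    (m1 : {measure set T1 -> \bar R}) (m2 : {measure set T2 -> \bar R})
    (h1 : T1 -> R) (h2 : T2 -> R) (Y1 : T1 -> S) (Y2 : T2 -> S) :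
  (forall x, (0 <= h1 x)%R) -> measurable_fun setT h1 ->
  (forall x, (0 <= h2 x)%R) -> measurable_fun setT h2 ->
  measurable_fun setT Y1 -> measurable_fun setT Y2 ->
  (forall C, measurable C -> \int[m1]_(x in Y1 @^-1` C) (h1 x)%:E =
                             \int[m2]_(x in Y2 @^-1` C) (h2 x)%:E) ->
  forall u : S -> \bar R, (forall y, 0 <= u y) -> measurable_fun setT u ->
  \int[m1]_x (u (Y1 x) * (h1 x)%:E) = \int[m2]_x (u (Y2 x) * (h2 x)%:E).
Proof.
move=> h10 mh1 h20 mh2 mY1 mY2 eqC u u0 mu.
have mu1 : measurable_fun setT (u \o Y1) by exact: measurableT_comp.
have mu2 : measurable_fun setT (u \o Y2) by exact: measurableT_comp.
rewrite -(integral_density_measure m1 h10 mh1 _ mu1).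
rewrite -(integral_density_measure m2 h20 mh2 _ mu2).
have uin : {in setT, forall y, 0 <= u y} by move=> y _.
rewrite -[LHS](@ge0_integral_pushforward _ _ _ _ _ Y1 mY1 _ setT)//.
rewrite -[RHS](@ge0_integral_pushforward _ _ _ _ _ Y2 mY2 _ setT)//.
  by apply: eq_measure_integral => C mC _; exact: eqC.
all: by move=> x; exact: u0.
Qed.

Section ProductFormula.
Context {R : realType} {d : measure_display} {Omega : measurableType d}.
Variable P : probability Omega R.
Context {I : choiceType} {dE : I -> measure_display}.
Context {E : forall i, measurableType (dE i)}.
Variable Y : forall i, Omega -> E i.
Hypothesis mY : forall i, measurable_fun setT (Y i).
Hypothesis indepY : mutually_independent P Y.
Variable u : forall i, E i -> R.
Arguments u : clear implicits.
Hypothesis u0 : forall i x, (0 <= u i x)%R.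
Hypothesis mu : forall i, measurable_fun setT (u i).
Hypothesis u_fin : forall i, \int[P]_w (u i (Y i w))%:E < +oo.

Local Notation mean i := (\int[P]_w (u i (Y i w))%:E).
Local Notation cylinder J B := (\bigcap_(i in [set` (J : {fset I})]) (Y i @^-1` B i)).

Let mean_ge0 i : 0 <= mean i.
Proof. by apply: integral_ge0 => w _; rewrite lee_fin. Qed.

Let mpre i C : measurable C -> measurable (Y i @^-1` C).
Proof. by move=> mC; rewrite -[X in measurable X]setTI; exact: mY. Qed.

Let prod_ge0 (ps : seq I) w : (0 <= \prod_(i <- ps) u i (Y i w))%R.
Proof. by apply: prodr_ge0. Qed.

Let mprod (ps : seq I) :
  measurable_fun setT (fun w => (\prod_(i <- ps) u i (Y i w))%R).
Proof. by apply: measurable_prod => i _; exact: measurableT_comp. Qed.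

(** The induction removes one factor at a time.  As a function of C, the integral
    of the remaining factors over the cylinder cut down by {Y i0 in C} is a
    multiple of the law of Y i0, by the induction hypothesis for the enlarged
    cylinder; integrating u i0 against both sides gives the step.  Carrying the
    cylinder is what makes this hypothesis available. *)
Lemma integral_cylinder_prod (ps : seq I) (J : {fset I}) (B : forall i, set (E i)) :
  uniq ps -> (forall i, i \in ps -> i \notin J) ->
  (forall i, measurable (B i)) ->
  \int[P]_(w in cylinder J B) (\prod_(i <- ps) u i (Y i w))%:E =
  P (cylinder J B) * \prod_(i <- ps) mean i.
Proof.
elim: ps J B => [|i0 ps IH] J B.
  move=> _ _ mB; rewrite big_nil mule1.
  under eq_integral do rewrite big_nil.
  rewrite integral_cst ?mul1e//.
  by rewrite bigcap_fset; apply: bigsetI_measurable => i _; exact: mpre.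
move=> /= /andP[i0ps ups] disj mB.
have mcyl (J' : {fset I}) B' :
    (forall i, measurable (B' i)) -> measurable (cylinder J' B').
  move=> mB'; rewrite bigcap_fset; apply: bigsetI_measurable => i _; exact: mpre.
pose G := cylinder J B.
have mG : measurable G by exact: mcyl.
pose kap := fine (P G * \prod_(i <- ps) mean i).
have Pfin : P G * \prod_(i <- ps) mean i \is a fin_num.
  rewrite fin_numM//; first exact: fin_num_measure.
  by apply: prode_fin_num => i _; rewrite ge0_fin_numE.
have kap0 : (0 <= kap)%R.
  by rewrite fine_ge0// mule_ge0// prode_ge0.
have i0J : i0 \notin J by apply: disj; rewrite mem_head.
have eqC C : measurable C ->
    \int[P]_(w in Y i0 @^-1` C) (\1_G w * \prod_(i <- ps) u i (Y i w))%:E =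
    \int[P]_(w in Y i0 @^-1` C) (cst kap w)%:E.
  move=> mC; transitivity (kap%:E * P (Y i0 @^-1` C)); last first.
    by symmetry; exact: (integral_cst P (mpre mC) kap%:E).
  have mB' i : measurable (eqtype.dfwith B C i).
    have [<-|ne] := eqVneq i0 i; first by rewrite dfwith_in.
    by rewrite dfwith_out.
  have cylE : cylinder (i0 |` J)%fset (eqtype.dfwith B C) = Y i0 @^-1` C `&` G.
    rewrite bigcap_fsetU1 dfwith_in; congr (_ `&` _).
    apply: eq_bigcapr => i /= iJ; rewrite dfwith_out//.
    by apply: contraNneq i0J => ->.
  transitivity (\int[P]_(w in Y i0 @^-1` C `&` G) (\prod_(i <- ps) u i (Y i w))%:E).
    rewrite integral_mkcondr; apply: eq_integral => w _.
    by rewrite mulrC EFinM epatch_indic.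
  rewrite -cylE IH//; last first.
    move=> i ips; rewrite in_fset1U negb_or; apply/andP; split.
      by apply: contraNneq i0ps => <-.
    by apply: disj; rewrite inE ips orbT.
  rewrite /kap fineK// muleAC; congr (_ * _).
  rewrite indepY// big_fsetU1//= dfwith_in muleC; congr (_ * _).
  rewrite /G indepY//; apply: eq_big_seq => i iJ.
  by rewrite dfwith_out//; apply: contraNneq i0J => ->.
have := @integral_transfer R _ _ _ _ _ _ P P _ _ (Y i0) (Y i0)
  _ _ _ _ _ _ eqC (EFin \o u i0).
move=> tr.
rewrite big_cons muleCA -(fineK Pfin) -/kap -ge0_integralZr//.
- rewrite /= in tr; rewrite -tr//.
  + rewrite integral_mkcond; apply: eq_integral => w _.
    by rewrite epatch_indic -!EFinM big_cons; congr EFin; rewrite -/G; ring.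
  + move=> w; rewrite mulr_ge0//.
  + by apply: measurable_funM.
  + by move=> y; rewrite lee_fin.
  + exact/measurable_EFinP.
- by apply/measurable_EFinP; exact: measurableT_comp.
- by move=> w _; rewrite lee_fin.
Qed.

Lemma integral_prod_indep (ps : seq I) : uniq ps ->
  \int[P]_w (\prod_(i <- ps) u i (Y i w))%:E = \prod_(i <- ps) mean i.
Proof.
move=> ups.
have := @integral_cylinder_prod ps fset0 (fun=> setT) ups.
have -> : cylinder fset0 (fun=> setT) = setT.
  by apply/seteqP; split => // w _ i.
by rewrite probability_setT mul1e; exact.
Qed.

End ProductFormula.

(** * The filtration generated by the streams *)

Section Filtration.
Context {R : realType} {K : nat}.
Context {dX : 'I_K -> measure_display} {X : forall k, measurableType (dX k)}.
Context {dO : measure_display} {Omega : measurableType dO}.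
Variable xi : forall k : 'I_K, nat -> Omega -> X k.
Hypothesis mxi : forall k s, measurable_fun setT (xi k s).

Definition box (s : nat) (B : forall p : 'I_K * nat, set (X p.1)) : set Omega :=
  [set w | forall p : 'I_K * nat, (p.2 < s)%N -> B p (xi p.1 p.2 w)].

(** A pi-system that generates the filtration at time s. *)
Definition boxes (s : nat) : set_system Omega :=
  [set box s B | B in [set B | forall p, measurable (B p)]].

Let mpre (p : 'I_K * nat) C : measurable C -> measurable (xi p.1 p.2 @^-1` C).
Proof. by move=> mC; rewrite -[X in measurable X]setTI; exact: mxi. Qed.

Lemma measurable_box s B : (forall p, measurable (B p)) -> measurable (box s B).
Proof.
move=> mB.
have -> : box s B = \bigcap_(j in `I_s) \bigcap_(k in [set: 'I_K])
    (xi k j @^-1` B (k, j)).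
  apply/seteqP; split => [w Bw j /= js k _|w Bw [k j] js]; first exact: Bw.
  exact: Bw.
apply: bigcap_measurableType => j _.
apply: fin_bigcap_measurable => [|k _]; first exact: finite_finset.
exact: (mpre (p := (k, j))).
Qed.

Lemma setI_closed_boxes s : setI_closed (boxes s).
Proof.
move=> _ _ [B mB <-] [C mC <-]; exists (fun p => B p `&` C p).
  by move=> p; exact: measurableI.
apply/seteqP; split => [w BC|w [Bw Cw] p ps]; last by split; [exact: Bw|exact: Cw].
by split => p ps; have [] := BC p ps.
Qed.

Lemma filtration_boxes s : filtration xi s `<=` <<s boxes s >>.
Proof.
apply: smallest_sub; first exact: smallest_sigma_algebra.
move=> _ [k _ [j /= js [C mC <-]]]; apply: sub_sigma_algebra.
exists (eqtype.dfwith (fun p : 'I_K * nat => @setT (X p.1)) (i := (k, j)) C).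
  move=> p; have [<-|ne] := eqVneq (k, j) p; first by rewrite dfwith_in.
  by rewrite dfwith_out.
rewrite setTI; apply/seteqP; split => [w /(_ (k, j) js)|w Cw p ps].
  by rewrite dfwith_in.
have [<-|ne] := eqVneq (k, j) p; first by rewrite dfwith_in.
by rewrite dfwith_out.
Qed.

Lemma filtration_measurable s : filtration xi s `<=` measurable.
Proof.
apply: smallest_sub; first exact: sigma_algebra_measurable.
by move=> _ [k _ [j /= js [C mC <-]]]; exact: mxi.
Qed.

Lemma filtration_le s t : (s <= t)%N -> filtration xi s `<=` filtration xi t.
Proof.
move=> st; apply: sub_smallest2r; first exact: smallest_sigma_algebra.
move=> E [k _ [j /= js Ej]]; exists k => //; exists j => //=.
exact: leq_trans js st.
Qed.

(** Identities between weighted probabilities need only be checked on boxes,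
    where independence turns them into products over single observations. *)
Lemma eq_integral_filtration (P Q : probability Omega R) (h1 h2 : Omega -> R)
    (s : nat) :
  (forall w, (0 <= h1 w)%R) -> measurable_fun setT h1 ->
  (forall w, (0 <= h2 w)%R) -> measurable_fun setT h2 ->
  \int[P]_w (h1 w)%:E < +oo ->
  (forall B, (forall p, measurable (B p)) ->
    \int[P]_(w in box s B) (h1 w)%:E = \int[Q]_(w in box s B) (h2 w)%:E) ->
  forall E, filtration xi s E ->
    \int[P]_(w in E) (h1 w)%:E = \int[Q]_(w in E) (h2 w)%:E.
Proof.
move=> h10 mh1 h20 mh2 fin eqB E /filtration_boxes sE.
have boxT : boxes s setT by exists (fun=> setT) => //; apply/seteqP; split.
apply: (@g_sigma_algebra_measure_unique _ R _ (boxes s) _ (fun=> setT) _ _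
  (density_measure P h10 mh1) (density_measure Q h20 mh2)) => //.
- by move=> _ [B mB <-]; exact: measurable_box.
- by rewrite bigcup_const.
- exact: setI_closed_boxes.
- by move=> _ [B mB <-]; exact: eqB.
Qed.

End Filtration.

(** * Procedures *)

Section StoppedEvents.
Context {R : realType} {K : nat}.
Context {dX : 'I_K -> measure_display} {X : forall k, measurableType (dX k)}.
Context {dO : measure_display} {Omega : measurableType dO}.
Variable xi : forall k : 'I_K, nat -> Omega -> X k.
Hypothesis hxi : forall k s, measurable_fun setT (xi k s).
Variable calA : {set {set 'I_K}}.
Variable delta : @procedure R K dO Omega.
Hypothesis hdelta : procedures xi calA delta.

Definition stopped (s : nat) (D : set {set 'I_K}) : set Omega :=
  [set w | delta.1 w = s%:R%:E /\ D (delta.2 w)].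

Lemma filtration_stopped s D : filtration xi s (stopped s D).
Proof.
have [[Tval Tst] _ Dst] := hdelta.
pose G := \bigcup_(k in [set: 'I_K]) \bigcup_(j in `I_s)
  preimage_set_system setT (xi k j) measurable.
case: s @G => [|s] G.
  (* Stopping times are at least 1. *)
  have -> : stopped 0 D = set0.
    apply/seteqP; split => // w [Tw _]; have [|[t t0]] := Tval w; rewrite Tw//.
    by move=> [/eqP]; rewrite eqr_nat; case: t t0.
  exact: (@measurable0 _ (g_sigma_algebraType G)).
(* For s = 0 the definition of a stopping time is silent, but the event is empty. *)
have prev : filtration xi s.+1 [set w | delta.1 w <= s%:R%:E].
  case: s @G => [|s] G; last by apply: filtration_le (Tst s.+1 _).
  have -> : [set w | delta.1 w <= 0%:R%:E] = set0.
    apply/seteqP; split => // w /=; have [->//|[t t0 ->]] := Tval w.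
    by rewrite lee_fin ler_nat; case: t t0.
  exact: (@measurable0 _ (g_sigma_algebraType G)).
have -> : stopped s.+1 D = (delta.2 @^-1` D `&` [set w | delta.1 w <= s.+1%:R%:E])
    `\` [set w | delta.1 w <= s%:R%:E].
  apply/seteqP; split => [w [Tw Dw]|w [[Dw /= T1] /negP T2]].
    split; first by split => //=; rewrite Tw.
    by move=> /=; rewrite Tw lee_fin ler_nat ltnn.
  split => //; have [Tw|[t t0 Tw]] := Tval w; first by rewrite Tw in T1.
  move: T1 T2; rewrite Tw !lee_fin !ler_nat -ltnNge => t1 t2.
  by have -> : t = s.+1 by apply/eqP; rewrite eqn_leq t1.
apply: (@measurableD _ (g_sigma_algebraType G)); last exact: prev.
exact: (proj2 (Dst D)).
Qed.

Lemma measurable_stopped s D : measurable (stopped s D).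
Proof. exact: (filtration_measurable hxi (@filtration_stopped s D)). Qed.

(** A stopping time takes countably many values, each on a measurable event. *)
Lemma measurable_stopping_time : measurable_fun setT delta.1.
Proof.
have [[Tval _] _ _] := hdelta.
move=> _ Y mY; rewrite setTI.
have -> : delta.1 @^-1` Y = (\bigcup_(s in [set s : nat | Y s%:R%:E]) stopped s setT)
    `|` ([set _ | Y +oo] `&` ~` (\bigcup_s stopped s setT)).
  apply/seteqP; split => [w /= Yw|w [[s /= Ys [Tw _]]|[/= Yy nT]]].
  - have [Tw|[t t0 Tw]] := Tval w; last first.
      by left; exists t; rewrite /= -?Tw.
    right; split; first by rewrite /= -Tw.
    by move=> [s _ [Ts _]]; rewrite Ts in Tw.
  - by rewrite /preimage/= Tw.
  - have [Tw|[t t0 Tw]] := Tval w; first by rewrite /preimage/= Tw.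
    by exfalso; apply: nT; exists t.
apply: measurableU.
  by apply: bigcup_measurable => s _; exact: measurable_stopped.
apply: measurableI.
  have [Yy|nY] := pselect (Y +oo).
    by rewrite (_ : [set _ | _] = setT)//; apply/seteqP; split.
  by rewrite (_ : [set _ | _] = set0)//; apply/seteqP; split.
apply: measurableC; apply: bigcup_measurable => s _; exact: measurable_stopped.
Qed.

Lemma measurable_decision D : measurable (delta.2 @^-1` D).
Proof. by have [_ _ Dst] := hdelta; case: (Dst D). Qed.

Lemma stopping_time_ge0 w : 0 <= delta.1 w.
Proof.
by have [[Tval _] _ _] := hdelta; have [->//|[t _ ->]] := Tval w; rewrite lee_fin.
Qed.

Lemma sum_stopped_le (Q : probability Omega R) D :
  \sum_(0 <= s <oo) Q (stopped s D) <= Q (delta.2 @^-1` D).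
Proof.
have <- : Q (\bigcup_s stopped s D) = \sum_(0 <= s <oo) Q (stopped s D).
  apply: measure_semi_bigcup => [s||]; first exact: measurable_stopped.
    move=> i j _ _ [w [[Ti _] [Tj _]]].
    by move: Ti; rewrite Tj => -[/eqP]; rewrite eqr_nat => /eqP.
  by apply: bigcup_measurable => s _; exact: measurable_stopped.
apply: le_measure; rewrite ?inE.
- by apply: bigcup_measurable => s _; exact: measurable_stopped.
- exact: measurable_decision.
- by move=> w [s _ []].
Qed.

Lemma sum_decision_le1 (Q : probability Omega R) :
  \sum_(d in calA) Q (delta.2 @^-1` [set d]) <= 1.
Proof.
rewrite -big_enum/=.
have int1 d : Q (delta.2 @^-1` [set d]) =
    \int[Q]_w (\1_(delta.2 @^-1` [set d]) w)%:E.
  by rewrite integral_indic ?setIT//; exact: measurable_decision.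
under eq_bigr do rewrite int1.
rewrite -ge0_integral_sum//; last first.
  by move=> d; apply/measurable_EFinP/measurable_indic/measurable_decision.
apply: (@le_trans _ _ (\int[Q]_w (cst 1 w))); last first.
  by rewrite integral_cst// mul1e; exact: probability_le1.
apply: ge0_le_integral => //.
- by move=> w _; apply: sume_ge0 => d _; rewrite lee_fin.
- apply: emeasurable_sum => d.
  by apply/measurable_EFinP/measurable_indic/measurable_decision.
move=> w _; rewrite (bigD1_seq (delta.2 w)) ?enum_uniq//=; last first.
  by have [_ Din _] := hdelta; rewrite mem_enum Din.
rewrite big1 ?adde0; first by rewrite lee_fin indicE lern1 leq_b1.
by move=> d dw; rewrite indicE memNset//= => e; rewrite e eqxx in dw.
Qed.

End StoppedEvents.

(** * Hellinger affinity of two densities *)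

Lemma measurable_funV_ge0 {R : realType} {d : measure_display}
    {T : measurableType d} (g : T -> R) :
  (forall x, (0 <= g x)%R) -> measurable_fun setT g ->
  measurable_fun setT (fun x => ((g x)^-1)%R).
Proof.
move=> g0 mg.
have -> : (fun x => (g x)^-1%R) =
    (fun x => if (0 < g x)%R then expR (- ln (g x)) else 0%R).
  apply/funext => x; case: ltP => gx; first by rewrite expRN lnK.
  have /eqP -> : g x == 0%R by rewrite eq_le gx g0.
  by rewrite invr0.
apply: measurable_fun_ifT; first exact: measurable_fun_ltr.
  apply: measurableT_comp => //; apply: measurableT_comp => //.
  by apply: measurableT_comp => //; exact: measurable_ln.
exact: measurable_cst.
Qed.

Section Affinity.
Context {R : realType} {d : measure_display} {T : measurableType d}.
Variable mu : {measure set T -> \bar R}.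

Definition root_ratio (g h : T -> R) (x : T) : R := Num.sqrt (h x / g x).

(** The Hellinger affinity, the integral of sqrt (g h), written as the mean under
    g of the root of the likelihood ratio.  The convention x / 0 = 0 is harmless
    because of the factor g. *)
Definition affinity (g h : T -> R) : \bar R :=
  \int[mu]_x (root_ratio g h x * g x)%:E.

Lemma measurable_root_ratio (g h : T -> R) :
  (forall x, (0 <= g x)%R) -> measurable_fun setT g -> measurable_fun setT h ->
  measurable_fun setT (root_ratio g h).
Proof.
move=> g0 mg mh.
have msqrt : measurable_fun setT (@Num.sqrt R).
  apply: continuous_measurable_fun; exact: sqrt_continuous.
apply: measurableT_comp => //.
by apply: measurable_funM => //; exact: measurable_funV_ge0.
Qed.

Section Densities.
Variables g h : T -> R.
Hypotheses (dg : is_density mu g) (dh : is_density mu h).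

Let mg : measurable_fun setT g. Proof. by case: dg. Qed.
Let mh : measurable_fun setT h. Proof. by case: dh. Qed.
Let g0 x : (0 <= g x)%R. Proof. by case: dg. Qed.
Let h0 x : (0 <= h x)%R. Proof. by case: dh. Qed.

Let gap x : R := (Num.sqrt (g x) - Num.sqrt (h x)) ^+ 2.

Let mgap : measurable_fun setT gap.
Proof.
have msqrt : measurable_fun setT (@Num.sqrt R).
  apply: continuous_measurable_fun; exact: sqrt_continuous.
by apply: measurable_funX; apply: measurable_funB; exact: measurableT_comp.
Qed.

Let root_ratioM x : (root_ratio g h x * g x = Num.sqrt (g x) * Num.sqrt (h x))%R.
Proof.
rewrite /root_ratio sqrtrM//; have [->|gx] := eqVneq (g x) 0%R.
  by rewrite mulr0 sqrtr0 mul0r.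
rewrite -[X in (_ * X)%R](sqr_sqrtr (g0 x)) sqrtrV//.
have sg : Num.sqrt (g x) != 0%R by rewrite sqrtr_eq0 -ltNge lt_neqAle eq_sym gx g0.
by field.
Qed.

(** (sqrt g - sqrt h)^2 = g + h - 2 sqrt (g h), and g and h integrate to 1. *)
Lemma affinityE : affinity g h + 2^-1%:E * \int[mu]_x (gap x)%:E = 1.
Proof.
have ig : \int[mu]_x (g x)%:E = 1 by case: dg.
have ih : \int[mu]_x (h x)%:E = 1 by case: dh.
have gap0 x : (0 <= gap x)%R by exact: sqr_ge0.
rewrite -ge0_integralZl//; last 2 first.
- exact/measurable_EFinP.
- by move=> x _; rewrite lee_fin.
rewrite /affinity -ge0_integralD//; last 4 first.
- by move=> x _; rewrite lee_fin mulr_ge0// sqrtr_ge0.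
- apply/measurable_EFinP/measurable_funM => //; exact: measurable_root_ratio.
- by move=> x _; rewrite -EFinM lee_fin mulr_ge0.
- by apply: measurable_funeM; exact/measurable_EFinP.
transitivity (\int[mu]_x (2^-1%:E * ((g x)%:E + (h x)%:E))).
  apply: eq_integral => x _; rewrite -!EFinM -!EFinD; congr EFin.
  rewrite root_ratioM /gap.
  have := sqr_sqrtr (g0 x); have := sqr_sqrtr (h0 x).
  by move: (Num.sqrt (g x)) (Num.sqrt (h x)) => a b <- <-; field.
rewrite ge0_integralZl//; last 2 first.
- by apply: emeasurable_funD; exact/measurable_EFinP.
- by move=> x _; rewrite -EFinD lee_fin addr_ge0.
rewrite ge0_integralD//; last 4 first.
- by move=> x _; rewrite lee_fin.
- exact/measurable_EFinP.
- by move=> x _; rewrite lee_fin.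
- exact/measurable_EFinP.
by rewrite ig ih -EFinD -EFinM; congr EFin; field.
Qed.

Lemma affinity_ge0 : 0 <= affinity g h.
Proof.
by apply: integral_ge0 => x _; rewrite lee_fin mulr_ge0// sqrtr_ge0.
Qed.

Lemma affinity_le1 : affinity g h <= 1.
Proof.
rewrite -affinityE leeDl// mule_ge0// integral_ge0// => x _.
by rewrite lee_fin sqr_ge0.
Qed.

(** If the affinity were 1, then g = h almost everywhere, so the log-ratio would
    be 0 almost everywhere on {h > 0} and its mean would vanish. *)
Lemma affinity_lt1 : 0 < log_ratio_mean mu h g -> affinity g h < 1.
Proof.
move=> mean_gt0; rewrite lt_neqAle affinity_le1 andbT; apply/eqP => aff1.
have gap_eq0 : \int[mu]_x `|(gap x)%:E| = 0.
  under eq_integral do rewrite gee0_abs ?lee_fin ?sqr_ge0//.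
  have := affinityE; rewrite aff1.
  set J := integral _ _ _.
  have : 0 <= J by rewrite integral_ge0// => x _; rewrite lee_fin sqr_ge0.
  case: J => [r r0||//].
    by rewrite -EFinM -EFinD => -[e]; congr EFin; lra.
  by move=> _; rewrite gt0_muley ?lte_fin// addey.
move/(ae_eq_integral_abs mu measurableT): gap_eq0.
move=> /(_ (proj2 (measurable_EFinP _ _) mgap)) ae0.
suff: log_ratio_mean mu h g = 0 by move=> e; rewrite e ltxx in mean_gt0.
(* This form of the integrand makes its measurability evident. *)
have log_ratioE x : log_ratio h g x * (h x)%:E =
    if (0 < h x)%R then
      if (0 < g x)%R then (ln (h x / g x) * h x)%:E else +oo
    else 0.
  rewrite /log_ratio; case: ifPn => hx; last first.
    have /eqP -> : h x == 0%R by rewrite eq_le h0 leNgt hx.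
    by rewrite mule0.
  case: ifPn => gx.
    rewrite inver gt_eqF// -EFinM /lne leNgt divr_gt0//.
  have /eqP -> : g x == 0%R by rewrite eq_le g0 leNgt gx.
  by rewrite inve0 gt0_muley ?lte_fin// gt0_mulye ?lte_fin.
rewrite /log_ratio_mean.
transitivity (\int[mu]_x (cst 0 x : \bar R)); last by rewrite integral0.
apply: ae_eq_integral => //.
  under eq_fun do rewrite log_ratioE.
  apply: measurable_fun_ifT => //; first exact: measurable_fun_ltr.
  apply: measurable_fun_ifT => //; first exact: measurable_fun_ltr.
  apply/measurable_EFinP/measurable_funM => //.
  apply: measurableT_comp; first exact: measurable_ln.
  by apply: measurable_funM => //; exact: measurable_funV_ge0.
move: ae0; apply: filterS => x /(_ I) /= gapx _.
have /eqP e : Num.sqrt (g x) == Num.sqrt (h x).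
  by move: gapx => -[/eqP]; rewrite sqrf_eq0 subr_eq0.
have gh : g x = h x by rewrite -(sqr_sqrtr (g0 x)) e sqr_sqrtr.
rewrite log_ratioE gh; case: ifPn => // hx.
by rewrite ?hx divff ?gt_eqF// ln1 mul0r.
Qed.

End Densities.
End Affinity.

(** * Products along the observed path *)

Section Model.
Context {R : realType} {K : nat}.
Context {dX : 'I_K -> measure_display} {X : forall k, measurableType (dX k)}.
Variable mu : forall k, {sigma_finite_measure set (X k) -> \bar R}.
Arguments mu : clear implicits.
Variable f : bool -> forall k, X k -> R.
Arguments f : clear implicits.
Hypothesis hf : forall b k, is_density (mu k) (f b k).
Context {dO : measure_display} {Omega : measurableType dO}.
Variable xi : forall k : 'I_K, nat -> Omega -> X k.
Arguments xi : clear implicits.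
Hypothesis hxi : forall k s, measurable_fun setT (xi k s).
Variable P : {set 'I_K} -> probability Omega R.
Hypothesis hP : forall A, stream_law mu f xi A (P A).

Let f0 b k x : (0 <= f b k x)%R. Proof. by case: (hf b k). Qed.
Let mf b k : measurable_fun setT (f b k). Proof. by case: (hf b k). Qed.

Lemma integral_stream A k s (u : X k -> \bar R) :
  (forall x, 0 <= u x) -> measurable_fun setT u ->
  \int[P A]_w u (xi k s w) = \int[mu k]_x (u x * (f (k \in A) k x)%:E).
Proof.
move=> u0 mu'.
have := @integral_transfer R _ _ _ _ _ (X k) (P A) (mu k) (cst 1%R)
  (f (k \in A) k) (xi k s) id _ _ _ _ _ _ _ u u0 mu'.
move=> <- //.
- by apply: eq_integral => w _; rewrite mule1.
- move=> C mC; rewrite -[RHS](proj1 (hP A) k s C mC).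
  have mpre : measurable (xi k s @^-1` C).
    by rewrite -[X in measurable X]setTI; exact: hxi.
  by have := integral_cst (P A) mpre 1; rewrite mul1e.
Qed.

Definition observations (m : nat) : seq ('I_K * nat) :=
  [seq (k, j) | j <- iota 0 m, k <- enum 'I_K].

Lemma mem_observations m p : (p \in observations m) = (p.2 < m)%N.
Proof.
apply/allpairsP/idP => [[[j k] /= [jm _ ->]]|].
  by rewrite mem_iota add0n in jm.
case: p => k j /= jm; exists (j, k) => /=.
by rewrite mem_iota mem_enum.
Qed.

Lemma uniq_observations m : uniq (observations m).
Proof.
by apply: allpairs_uniq; rewrite ?iota_uniq ?enum_uniq// => -[? ?] [? ?] _ _ [-> ->].
Qed.

Definition path_prod (u : forall p : 'I_K * nat, X p.1 -> R) (m : nat) (w : Omega)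
    : R :=
  \prod_(p <- observations m) u p (xi p.1 p.2 w).

Lemma path_prodE u m w :
  path_prod u m w = (\prod_(j < m) \prod_k u (k, nat_of_ord j) (xi k j w))%R.
Proof.
rewrite /path_prod big_allpairs_dep /= -[in LHS](subn0 m) -/(index_iota 0 m).
rewrite big_mkord.
by apply: eq_bigr => j _; rewrite big_enum.
Qed.

Section PathProd.
Variable u : forall p : 'I_K * nat, X p.1 -> R.
Arguments u : clear implicits.
Hypothesis u0 : forall p x, (0 <= u p x)%R.
Hypothesis mu' : forall p, measurable_fun setT (u p).

Lemma path_prod_ge0 m w : (0 <= path_prod u m w)%R.
Proof. by apply: prodr_ge0. Qed.

Lemma measurable_path_prod m : measurable_fun setT (path_prod u m).
Proof.
by apply: measurable_prod => p _; apply: measurableT_comp => //; exact: hxi.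
Qed.

Lemma indic_box s B w :
  \1_(box xi s B) w = (\prod_(p <- observations s) \1_(B p) (xi p.1 p.2 w) : R)%R.
Proof.
have [Bw|nBw] := pselect (box xi s B w).
  rewrite indicE mem_set//= big_seq big1// => p.
  by rewrite mem_observations => ps; rewrite indicE mem_set//; exact: Bw.
rewrite indicE memNset//=.
have [p nBp] : exists p, ~ ((p.2 < s)%N -> B p (xi p.1 p.2 w)).
  by apply/existsNP.
have [ps nB] := (iffLR (not_implyP _ _)) nBp.
rewrite (bigD1_seq p) ?mem_observations ?uniq_observations//=.
by rewrite indicE memNset// mul0r.
Qed.

(** The box constrains only the first s times, so the indicator of the box is
    absorbed into the factors of these times and the later ones stay free. *)
Lemma integral_box_path_prod A s t B : (forall p, measurable (B p)) ->
  (forall p, \int[P A]_w (u p (xi p.1 p.2 w))%:E < +oo) ->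
  \int[P A]_(w in box xi s B) (path_prod u (s + t) w)%:E =
  (\prod_(p <- observations s)
     \int[P A]_w (\1_(B p) (xi p.1 p.2 w) * u p (xi p.1 p.2 w))%:E) *
  \prod_(s <= j < s + t) \prod_k \int[P A]_w (u (k, j) (xi k j w))%:E.
Proof.
move=> mB u_fin.
pose v (p : 'I_K * nat) (x : X p.1) : R :=
  ((if (p.2 < s)%N then \1_(B p) x else 1) * u p x)%R.
have v0 p x : (0 <= v p x)%R by rewrite mulr_ge0//; case: ifP.
have mv p : measurable_fun setT (v p).
  by apply: measurable_funM => //; case: (p.2 < s)%N => //; exact: measurable_indic.
have v_fin p : \int[P A]_w (v p (xi p.1 p.2 w))%:E < +oo.
  apply: le_lt_trans (u_fin p); apply: ge0_le_integral => //.
  - by move=> w _; rewrite lee_fin.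
  - by apply/measurable_EFinP; apply: measurableT_comp => //; exact: hxi.
  - by apply/measurable_EFinP; apply: measurableT_comp => //; exact: hxi.
  - move=> w _; rewrite lee_fin /v ler_piMl//; case: (p.2 < s)%N => //.
have obsE : observations (s + t) =
    observations s ++ [seq (k, j) | j <- iota s t, k <- enum 'I_K].
  by rewrite /observations iotaD allpairs_cat.
transitivity (\int[P A]_w (\prod_(p <- observations (s + t)) v p (xi p.1 p.2 w))%:E).
  rewrite integral_mkcond; apply: eq_integral => w _.
  rewrite epatch_indic -EFinM; congr EFin.
  rewrite /path_prod indic_box obsE !big_cat/= mulrAC; congr (_ * _)%R.
    rewrite -big_split/=; apply: eq_big_seq => p.
    by rewrite mem_observations => ps; rewrite /v ps mulrC.
  apply: eq_big_seq => p /allpairsP[[j k] /= [jst _ ->]].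
  by move: jst; rewrite mem_iota => /andP[sj _]; rewrite /v/= ltnNge sj mul1r.
have mxi (p : 'I_K * nat) : measurable_fun setT (xi p.1 p.2) by exact: hxi.
rewrite (integral_prod_indep mxi (proj2 (hP A)) v0 mv v_fin (uniq_observations _)).
rewrite obsE big_cat/=; congr (_ * _).
  by apply: eq_big_seq => p; rewrite mem_observations /v => ->.
rewrite big_allpairs_dep /index_iota addKn; apply: eq_big_seq => j.
rewrite mem_iota => /andP[sj _]; rewrite big_enum; apply: eq_bigr => k _.
by rewrite /v/= ltnNge sj; under eq_integral do rewrite mul1r.
Qed.

Lemma path_prod_fin A m :
  (forall p, \int[P A]_w (u p (xi p.1 p.2 w))%:E < +oo) ->
  \int[P A]_w (path_prod u m w)%:E < +oo.
Proof.
move=> u_fin.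
have := @integral_box_path_prod A 0 m (fun=> setT) (fun=> measurableT) u_fin.
have -> : box xi 0 (fun=> setT) = setT by apply/seteqP; split.
rewrite add0n => ->; rewrite ltey_eq; apply/orP; left.
apply: fin_numM; apply: prode_fin_num.
  move=> p _; rewrite ge0_fin_numE; last first.
    by apply: integral_ge0 => w _; rewrite lee_fin mulr_ge0.
  by apply: le_lt_trans (u_fin p); under eq_integral do rewrite indicT mul1r.
move=> j _; apply: prode_fin_num => k _; rewrite ge0_fin_numE ?(u_fin (k, j))//.
by apply: integral_ge0 => w _; rewrite lee_fin.
Qed.

End PathProd.

(** * Likelihood ratios *)

Definition density_ratio (A B : {set 'I_K}) (p : 'I_K * nat) (x : X p.1) : R :=
  f (p.1 \in B) p.1 x / f (p.1 \in A) p.1 x.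

Definition sqrt_ratio (A B : {set 'I_K}) (p : 'I_K * nat) : X p.1 -> R :=
  root_ratio (f (p.1 \in A) p.1) (f (p.1 \in B) p.1).

Definition positive_density (A : {set 'I_K}) (p : 'I_K * nat) (x : X p.1) : R :=
  \1_[set x | 0 < f (p.1 \in A) p.1 x]%R x.
Arguments density_ratio : clear implicits.
Arguments sqrt_ratio : clear implicits.
Arguments positive_density : clear implicits.

Let ratio0 A B p x : (0 <= density_ratio A B p x)%R.
Proof. by rewrite divr_ge0. Qed.

Let mratio A B p : measurable_fun setT (density_ratio A B p).
Proof. by apply: measurable_funM => //; exact: measurable_funV_ge0. Qed.

Let root0 A B p x : (0 <= sqrt_ratio A B p x)%R.
Proof. exact: sqrtr_ge0. Qed.

Let mroot A B p : measurable_fun setT (sqrt_ratio A B p).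
Proof. exact: measurable_root_ratio. Qed.

Let mpos (A : {set 'I_K}) (p : 'I_K * nat) :
  measurable [set x | 0 < f (p.1 \in A) p.1 x]%R.
Proof.
rewrite -[X in measurable X]setTI.
have mfA := @mf (p.1 \in A) p.1.
have m0 : measurable_fun setT (cst 0%R : X p.1 -> R) by exact: measurable_cst.
exact: (measurable_fun_ltr m0 mfA measurableT (Y := [set true])).
Qed.

Let positive0 A p x : (0 <= positive_density A p x)%R.
Proof. by []. Qed.

Let mpositive A p : measurable_fun setT (positive_density A p).
Proof. exact: measurable_indic. Qed.

Lemma likelihoodE (A : {set 'I_K}) m w :
  likelihood xi f A m w =
  path_prod (fun p => f (p.1 \in A) p.1) m w.
Proof.
rewrite path_prodE; apply: eq_bigr => j _; rewrite /joint_density.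
rewrite [RHS](bigID (fun k => k \in A))/=; congr (_ * _)%R.
  by apply: eq_bigr => k ->.
by apply: eq_big => k; rewrite inE// => /negbTE ->.
Qed.

Lemma likelihood_ge0 (A : {set 'I_K}) m w : (0 <= likelihood xi f A m w)%R.
Proof. by rewrite likelihoodE; apply: prodr_ge0 => p _. Qed.

Lemma measurable_likelihood (A : {set 'I_K}) m :
  measurable_fun setT (likelihood xi f A m).
Proof.
rewrite (_ : likelihood xi f A m = path_prod (fun p => f (p.1 \in A) p.1) m).
  by apply: measurable_path_prod => // p; exact: mf.
by apply/funext => w; rewrite likelihoodE.
Qed.

Lemma likelihood_ratio A B m w : (0 < likelihood xi f A m w)%R ->
  likelihood xi f B m w =
  (path_prod (density_ratio A B) m w * likelihood xi f A m w)%R.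
Proof.
rewrite !likelihoodE /path_prod => pos; rewrite -big_split/=.
apply: eq_big_seq => p pm; rewrite /density_ratio divfK//.
apply/eqP => e; move: pos; rewrite (bigD1_seq p) ?uniq_observations//=.
by rewrite e mul0r ltxx.
Qed.

Lemma sqr_path_prod_sqrt_ratio A B m w :
  (path_prod (sqrt_ratio A B) m w ^+ 2 = path_prod (density_ratio A B) m w)%R.
Proof.
rewrite /path_prod -prodrXl; apply: eq_bigr => p _.
by rewrite sqr_sqrtr//; exact: ratio0.
Qed.

Let expectation_ratio A B p C : measurable C ->
  \int[P A]_w (\1_C (xi p.1 p.2 w) * density_ratio A B p (xi p.1 p.2 w))%:E =
  \int[P B]_w (\1_C (xi p.1 p.2 w) * positive_density A p (xi p.1 p.2 w))%:E.
Proof.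
move=> mC.
rewrite (integral_stream A p.2
  (u := fun x => (\1_C x * density_ratio A B p x)%:E)); last 2 first.
- by move=> x; rewrite lee_fin mulr_ge0.
- by apply/measurable_EFinP; apply: measurable_funM.
rewrite (integral_stream B p.2
  (u := fun x => (\1_C x * positive_density A p x)%:E)); last 2 first.
- by move=> x; rewrite lee_fin mulr_ge0.
- by apply/measurable_EFinP; apply: measurable_funM.
apply: eq_integral => x _; rewrite -!EFinM -!mulrA; congr (_ * _)%:E.
rewrite /density_ratio /positive_density indicE.
have [px|nx] := ltP 0%R (f (p.1 \in A) p.1 x).
  by rewrite mem_set// mul1r mulVf ?mulr1// gt_eqF.
rewrite memNset/=; last by apply/negP; rewrite -leNgt.
have /eqP -> : f (p.1 \in A) p.1 x == 0%R by rewrite eq_le nx f0.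
by rewrite !mulr0 mul0r.
Qed.

Let path_prod_le1 (u : forall p : 'I_K * nat, X p.1 -> R) m w :
  (forall (p : 'I_K * nat) x, (0 <= u p x <= 1)%R) -> (path_prod u m w <= 1)%R.
Proof. by move=> u01; apply: prodr_ile1 => p _. Qed.

(** On {f_A > 0} this is the change of measure with derivative f_B / f_A.  The part
    of P_B carried by {f_A = 0} is lost, whence an inequality. *)
Lemma change_of_measure A B s E : filtration xi s E ->
  \int[P A]_(w in E) (path_prod (density_ratio A B) s w)%:E <= P B E.
Proof.
move=> sE.
have pos01 p x : (0 <= positive_density A p x <= 1)%R.
  by rewrite positive0 /positive_density indicE lern1 leq_b1.
have mE := filtration_measurable hxi sE.
have pos_fin p : \int[P B]_w (positive_density A p (xi p.1 p.2 w))%:E < +oo.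
  apply: (@le_lt_trans _ _ (\int[P B]_w (cst 1 w))); last first.
    rewrite integral_cst// mul1e; apply: le_lt_trans (ltry 1%R).
    exact: probability_le1.
  apply: ge0_le_integral => //.
  - by move=> w _; rewrite lee_fin.
  - by apply/measurable_EFinP; apply: measurableT_comp => //; exact: hxi.
  - by move=> w _; rewrite lee_fin; case/andP: (pos01 p (xi p.1 p.2 w)).
have ratio_fin p : \int[P A]_w (density_ratio A B p (xi p.1 p.2 w))%:E < +oo.
  have := @expectation_ratio A B p setT measurableT.
  under eq_integral do rewrite indicT mul1r.
  by under [RHS]eq_integral do rewrite indicT mul1r; move=> ->.
(* The exact identity behind the inequality: the ratio integrates under P_A to
   the indicator of {f_A > 0} under P_B. *)
have boxE C : (forall p, measurable (C p)) ->
    \int[P A]_(w in box xi s C) (path_prod (density_ratio A B) s w)%:E =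
    \int[P B]_(w in box xi s C) (path_prod (positive_density A) s w)%:E.
  move=> mC; rewrite -{2 4}(addn0 s) !integral_box_path_prod//.
  rewrite addn0 !big_geq// !mule1; apply: eq_bigr => p _.
  exact: expectation_ratio.
rewrite (eq_integral_filtration hxi _ _ _ _ _ boxE sE); last 5 first.
- by move=> w; exact: path_prod_ge0.
- by apply: measurable_path_prod => //; exact: mratio.
- by move=> w; exact: path_prod_ge0.
- by apply: measurable_path_prod => //; exact: mpositive.
- by apply: path_prod_fin => //; exact: mratio.
rewrite -[leRHS]mul1e -integral_cst//; apply: ge0_le_integral => //.
- by move=> w _; rewrite lee_fin; exact: path_prod_ge0.
- apply: measurable_funTS; apply/measurable_EFinP.
  by apply: measurable_path_prod => //; exact: mpositive.
- by move=> w _; rewrite lee_fin; exact: path_prod_le1.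
Qed.

Definition total_affinity (A B : {set 'I_K}) : R :=
  \prod_k fine (affinity (mu k) (f (k \in A) k) (f (k \in B) k)).

Let affinity_fin (A B : {set 'I_K}) k :
  affinity (mu k) (f (k \in A) k) (f (k \in B) k) \is a fin_num.
Proof.
rewrite ge0_fin_numE ?affinity_ge0//.
by apply: le_lt_trans (ltry 1%R); exact: affinity_le1.
Qed.

Let expectation_root A B p :
  \int[P A]_w (sqrt_ratio A B p (xi p.1 p.2 w))%:E =
  affinity (mu p.1) (f (p.1 \in A) p.1) (f (p.1 \in B) p.1).
Proof.
rewrite (integral_stream A p.2 (u := EFin \o sqrt_ratio A B p))//.
  by move=> x /=; rewrite lee_fin.
exact/measurable_EFinP.
Qed.

Lemma total_affinity_ge0 A B : (0 <= total_affinity A B)%R.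
Proof.
by apply: prodr_ge0 => k _; rewrite fine_ge0// affinity_ge0.
Qed.

Lemma total_affinity_lt1 A B :
  (forall k i, 0 < log_ratio_mean (mu k) (f i k) (f (~~ i) k)) ->
  A != B -> (total_affinity A B < 1)%R.
Proof.
move=> hmean AB.
have [k kAB] : exists k, (k \in A) != (k \in B).
  apply/existsP; rewrite -negb_forall; apply: contraNN AB => /forallP AB.
  by apply/eqP/setP => k; exact/eqP.
have aff1 j : (fine (affinity (mu j) (f (j \in A) j) (f (j \in B) j)) <= 1)%R.
  by rewrite -lee_fin fineK// affinity_le1.
rewrite /total_affinity (bigD1 k)//=.
apply: (@le_lt_trans _ _ (fine (affinity (mu k) (f (k \in A) k) (f (k \in B) k)))).
  rewrite ler_piMr// ?fine_ge0 ?affinity_ge0//.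
  by apply: prodr_ile1 => j _; rewrite aff1 fine_ge0// affinity_ge0.
rewrite -lte_fin fineK//; apply: affinity_lt1 => //.
have -> : (k \in A) = ~~ (k \in B) by move: kAB; case: (k \in A); case: (k \in B).
exact: hmean.
Qed.

Let expectation_root_fin A B p :
  \int[P A]_w (sqrt_ratio A B p (xi p.1 p.2 w))%:E < +oo.
Proof. by rewrite expectation_root -ge0_fin_numE ?affinity_ge0. Qed.

(** The factors of the t times after s are independent of E, and those of one time
    have as their mean the product over the streams of the affinities. *)
Lemma sqrt_ratio_decay A B s t E : filtration xi s E ->
  \int[P A]_(w in E) (path_prod (sqrt_ratio A B) (s + t) w)%:E =
  (total_affinity A B ^+ t)%:E *
    \int[P A]_(w in E) (path_prod (sqrt_ratio A B) s w)%:E.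
Proof.
move=> sE.
have rho0 : (0 <= total_affinity A B ^+ t)%R.
  by rewrite exprn_ge0// total_affinity_ge0.
have mE := filtration_measurable hxi sE.
have pp0 m w : (0 <= path_prod (sqrt_ratio A B) m w)%R by exact: path_prod_ge0.
have mpp m : measurable_fun setT (path_prod (sqrt_ratio A B) m).
  by apply: measurable_path_prod => //; exact: mroot.
have scale D : measurable D ->
    (total_affinity A B ^+ t)%:E *
      \int[P A]_(w in D) (path_prod (sqrt_ratio A B) s w)%:E =
    \int[P A]_(w in D)
      (total_affinity A B ^+ t * path_prod (sqrt_ratio A B) s w)%:E.
  move=> mD; under [RHS]eq_integral do rewrite EFinM.
  rewrite ge0_integralZl ?lee_fin//.
    by apply: measurable_funTS; exact/measurable_EFinP.
  by move=> w _; rewrite lee_fin.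
rewrite scale//; apply: (eq_integral_filtration hxi _ _ _ _ _ _ sE) => //.
- by move=> w; rewrite mulr_ge0.
- exact: measurable_funM.
- by apply: path_prod_fin => //; exact: mroot.
move=> C mC; rewrite -scale; last exact: measurable_box.
have boxE r := integral_box_path_prod (@root0 A B) (@mroot A B) s r mC
  (@expectation_root_fin A B).
have := boxE 0%N; rewrite addn0 [X in _ * X]big_geq// mule1 => boxE0.
rewrite boxE boxE0 muleC; congr (_ * _).
transitivity (\prod_(s <= j < s + t) (total_affinity A B)%:E).
  apply: eq_bigr => j _; rewrite /total_affinity -prodEFin; apply: eq_bigr => k _.
  by rewrite fineK//; exact: (expectation_root A B (k, j)).
by rewrite prodEFin big_const_nat addKn -Monoid.iteropE.
Qed.

Local Notation lik := (likelihood xi f).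

Lemma likelihood_eq0_negligible (A : {set 'I_K}) m :
  (P A).-negligible [set w | lik A m w = 0%R].
Proof.
have fact p : (P A).-negligible [set w | f (p.1 \in A) p.1 (xi p.1 p.2 w) = 0%R].
  have mz : measurable [set x | f (p.1 \in A) p.1 x = 0%R].
    rewrite -[X in measurable X]setTI.
    exact: (mf (p.1 \in A) (k := p.1) measurableT (measurable_set1 0%R)).
  have mpre : measurable [set w | f (p.1 \in A) p.1 (xi p.1 p.2 w) = 0%R].
    by rewrite -[X in measurable X]setTI; exact: (@hxi p.1 p.2 measurableT _ mz).
  apply/negligibleP => //.
  rewrite [LHS](proj1 (hP A) p.1 p.2 [set x | f (p.1 \in A) p.1 x = 0%R] mz).
  by apply: integral0_eq => x /= ->.
have -> : [set w | lik A m w = 0%R] = [set w |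
    (\prod_(p <- observations m) f (p.1 \in A) p.1 (xi p.1 p.2 w) = 0)%R].
  by apply/seteqP; split => w /=; rewrite likelihoodE.
elim: (observations m) => [|p ps IH].
  rewrite (_ : [set _ | _] = set0); first exact: negligible_set0.
  by apply/seteqP; split => // w /=; rewrite big_nil => /eqP; rewrite oner_eq0.
apply: negligibleS (negligibleU (fact p) IH) => w /=.
by rewrite big_cons => /eqP; rewrite mulf_eq0 => /orP[|] /eqP; [left|right].
Qed.

(** * Probability that the truth fails to dominate *)

Definition not_dominating (A B : {set 'I_K}) (kap : R) (m : nat) : set Omega :=
  [set w | lik A m w <= kap * lik B m w]%R.

Lemma measurable_not_dominating (A B : {set 'I_K}) kap m :
  measurable (not_dominating A B kap m).
Proof.
have mA := measurable_likelihood A m.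
have mB := measurable_likelihood B m.
have mkB : measurable_fun setT (fun w => kap * lik B m w)%R.
  by apply: measurable_funM.
rewrite -[X in measurable X]setTI.
exact: (measurable_fun_ler mA mkB measurableT (Y := [set true])).
Qed.

(** Markov's inequality for the root of the likelihood ratio, then decay from time
    s + t to time s, then the inequality of means with a free weight b. *)
Lemma not_dominating_tail (A B : {set 'I_K}) (kap b : R) s t E :
  (0 <= kap)%R -> (0 < b)%R -> filtration xi s E ->
  P A (E `&` not_dominating A B kap (s + t)) <=
  (total_affinity A B ^+ t)%:E *
    ((b / 2)%:E * P A E + (kap / (2 * b))%:E * P B E).
Proof.
move=> kap0 b0 sE.
have mE := filtration_measurable hxi sE.
have pp0 m w : (0 <= path_prod (sqrt_ratio A B) m w)%R.
  by apply: path_prod_ge0 => p x; exact: sqrtr_ge0.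
have mpp m : measurable_fun setT (path_prod (sqrt_ratio A B) m).
  by apply: measurable_path_prod => // p; exact: measurable_root_ratio.
pose S := not_dominating A B kap (s + t).
have mS : measurable S by exact: measurable_not_dominating.
pose N := [set w | lik A (s + t) w = 0%R].
have mN : measurable N.
  rewrite -[X in measurable X]setTI.
  exact: (measurable_likelihood A (s + t) measurableT (measurable_set1 0%R)).
have PN : P A N = 0 by apply/negligibleP => //; exact: likelihood_eq0_negligible.
(* Where f_A vanishes, the ratio is 0 by convention and bounds nothing, but that
   event is P_A-null. *)
have step1 : P A (E `&` S) <=
    \int[P A]_(w in E) (Num.sqrt kap * path_prod (sqrt_ratio A B) (s + t) w)%:E.
  apply: (@le_trans _ _ (P A (E `&` (S `\` N)))).
    apply: (@le_trans _ _ (P A ((E `&` (S `\` N)) `|` N))).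
      apply: le_measure; rewrite ?inE.
      - exact: measurableI.
      - by apply: measurableU => //; apply: measurableI => //; exact: measurableD.
      - move=> w [Ew Sw]; have [Nw|Nw] := pselect (N w); [by right|by left].
    apply: le_trans (measureU2 _ _ _) _ => //.
    - by apply: measurableI => //; exact: measurableD.
    - by rewrite [X in _ + X]PN adde0.
  rewrite setIC -integral_indic//; last exact: measurableD.
  apply: ge0_le_integral => //.
  - by apply: measurable_funTS; apply/measurable_EFinP/measurable_indic/measurableD.
  - apply: measurable_funTS; apply/measurable_EFinP.
    by apply: measurable_funM.
  move=> w Ew; rewrite lee_fin indicE.
  have [/set_mem [Sw Nw]|_] := boolP (w \in S `\` N); last first.
    by rewrite mulr_ge0// sqrtr_ge0.
  have pos : (0 < lik A (s + t) w)%R.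
    by rewrite lt_neqAle eq_sym likelihood_ge0 andbT; apply/eqP.
  have := Sw; rewrite /S /not_dominating/= (likelihood_ratio B pos) mulrA.
  rewrite -[leLHS]mul1r ler_pM2r// -sqr_path_prod_sqrt_ratio => le1.
  rewrite -(@ler_pXn2r _ 2) ?nnegrE ?mulr_ge0 ?sqrtr_ge0//.
  by rewrite expr1n exprMn sqr_sqrtr.
apply: le_trans step1 _.
have scale m : \int[P A]_(w in E)
      (Num.sqrt kap * path_prod (sqrt_ratio A B) m w)%:E =
    (Num.sqrt kap)%:E * \int[P A]_(w in E) (path_prod (sqrt_ratio A B) m w)%:E.
  under eq_integral do rewrite EFinM.
  rewrite ge0_integralZl ?lee_fin ?sqrtr_ge0//.
    by apply: measurable_funTS; apply/measurable_EFinP.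
  by move=> w _; rewrite lee_fin.
rewrite scale (sqrt_ratio_decay A B t sE) muleCA -scale.
apply: lee_wpmul2l; first by rewrite lee_fin exprn_ge0// total_affinity_ge0.
have kb0 : (0 <= kap / (2 * b))%R by rewrite divr_ge0// mulr_ge0// ltW.
have b20 : (0 <= b / 2)%R by rewrite divr_ge0// ltW.
apply: (@le_trans _ _ (\int[P A]_(w in E) ((b / 2)%:E +
    (kap / (2 * b))%:E * (path_prod (density_ratio A B) s w)%:E))).
  have mR : measurable_fun E (fun w => (b / 2)%:E +
      (kap / (2 * b))%:E * (path_prod (density_ratio A B) s w)%:E).
    apply: measurable_funTS; apply: emeasurable_funD => //.
    apply: measurable_funeM; apply/measurable_EFinP.
    by apply: measurable_path_prod => p; exact: mratio.
  apply: ge0_le_integral => //.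
  - by move=> w _; rewrite lee_fin mulr_ge0// sqrtr_ge0.
  - apply: measurable_funTS; apply/measurable_EFinP.
    by apply: measurable_funM.
  move=> w _; rewrite -EFinM -EFinD lee_fin -sqr_path_prod_sqrt_ratio.
  set x := path_prod (sqrt_ratio A B) _ _; rewrite -subr_ge0.
  have -> : (b / 2 + kap / (2 * b) * x ^+ 2 - Num.sqrt kap * x =
      (b - Num.sqrt kap * x) ^+ 2 / (2 * b))%R.
    have := sqr_sqrtr kap0; move: (Num.sqrt kap) => y <-.
    by field; rewrite gt_eqF.
  by rewrite divr_ge0 ?sqr_ge0// mulr_ge0// ltW.
have mlr : measurable_fun E
    (fun w => (path_prod (density_ratio A B) s w)%:E).
  apply: measurable_funTS; apply/measurable_EFinP.
  by apply: measurable_path_prod => p; exact: mratio.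
have lr0 w : (0 <= path_prod (density_ratio A B) s w)%R.
  by apply: path_prod_ge0 => p x; rewrite divr_ge0.
rewrite ge0_integralD//; last 2 first.
- by move=> w _; rewrite -EFinM lee_fin mulr_ge0.
- exact: measurable_funeM.
rewrite ge0_integralZl ?lee_fin//; last first.
  by move=> w _; rewrite lee_fin.
rewrite integral_cst//; apply: leeD => //.
apply: lee_wpmul2l; first by rewrite lee_fin.
exact: change_of_measure.
Qed.

(** * Delay of the posterior-loss rule after a stopped procedure *)

Hypothesis hmean :
  forall k i, 0 < log_ratio_mean (mu k) (f i k) (f (~~ i) k).
Variable calA : {set {set 'I_K}}.
Variable W : {set 'I_K} -> {set 'I_K} -> R.
Hypothesis hW : is_loss calA W.

Let W0 d A : d \in calA -> A \in calA -> (0 <= W d A)%R.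
Proof. by case: hW => h _; exact: h. Qed.

Lemma exists_affinity_bound : exists rho : R, [/\ (0 < rho)%R, (rho < 1)%R &
  forall A B, A != B -> (total_affinity A B <= rho)%R].
Proof.
(* The seed 1/2 of the maximum keeps rho positive even if there are no pairs. *)
exists (\big[Num.max/2^-1%R]_(p : {set 'I_K} * {set 'I_K} | p.1 != p.2)
  total_affinity p.1 p.2); split.
- by apply: lt_le_trans (bigmax_ge_id _ _ _ _); rewrite invr_gt0.
- apply: bigmax_lt => [|[A B]]; first by rewrite invf_lt1 ?ltr1n.
  move=> /= AB; exact: total_affinity_lt1.
- by move=> A B AB; exact: (le_bigmax_cond _ _ (j := (A, B))).
Qed.

Local Notation n := (#|calA|%:R : R).

(** A decision that is correct under A and departs from d only if d is wrong
    under A. *)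
Definition fallback (A d : {set 'I_K}) : {set 'I_K} := if W d A == 0%R then d else A.

(** The obstruction that hypothesis B raises at time m to the posterior loss of
    [fallback A d] being below c. *)
Definition unresolved (c : R) (A d B : {set 'I_K}) (m : nat) : set Omega :=
  not_dominating A B (n * W (fallback A d) B / c)%R m.

Lemma fallback_mem A d : A \in calA -> d \in calA -> fallback A d \in calA.
Proof. by move=> ? ?; rewrite /fallback; case: ifP. Qed.

Lemma fallback_loss A d : A \in calA -> W (fallback A d) A = 0%R.
Proof.
by move=> A_in; rewrite /fallback; case: eqVneq => // _; case: hW => _; exact.
Qed.

(** If no B obstructs, each of the n terms W(d'|B) f_B of the unnormalized
    posterior loss is below (c / n) f_A, and the normalizing constant is at least
    f_A. *)
Lemma T_Ld_le c A d m w : (0 < c)%R -> A \in calA -> d \in calA -> (0 < m)%N ->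
  (forall B, B \in calA -> ~ unresolved c A d B m w) ->
  T_Ld xi calA W f c w <= m%:R%:E.
Proof.
move=> c0 A_in d_in m0 res; apply: ereal_inf_lbound.
exists m => //; split => //.
have n0 : (0 < n)%R by rewrite ltr0n; apply/card_gt0P; exists A.
have d'_in := fallback_mem A_in d_in.
have lik0 B := likelihood_ge0 B m w.
apply: (@le_lt_trans _ _ (posterior_loss xi calA W f m (fallback A d) w)%:E).
  exact: (bigmin_le_cond _ (P := fun d => d \in calA)).
have dom B : B \in calA ->
    (W (fallback A d) B * likelihood xi f B m w < c / n * likelihood xi f A m w)%R.
  move=> B_in; have /negP := res B B_in; rewrite -ltNge => lt.
  have nc0 : (n / c != 0)%R by rewrite gt_eqF// divr_gt0.
  rewrite -[ltLHS](mulKf nc0) invf_div ltr_pM2l ?divr_gt0//.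
  by rewrite mulrA [(n / c * _)%R]mulrAC.
(* The case B = A, where the loss is 0, gives positivity. *)
have pos : (0 < likelihood xi f A m w)%R.
  by have := dom A A_in; rewrite fallback_loss// mul0r pmulr_rgt0// divr_gt0.
have tot : (likelihood xi f A m w <= \sum_(B in calA) likelihood xi f B m w)%R.
  by rewrite (bigD1 A)//= lerDl sumr_ge0.
have tot0 := lt_le_trans pos tot.
rewrite lte_fin /posterior_loss /posterior.
have -> : (\sum_(B in calA) likelihood xi f B m w /
      (\sum_(B' in calA) likelihood xi f B' m w) * W (fallback A d) B =
    (\sum_(B in calA) W (fallback A d) B * likelihood xi f B m w) /
      (\sum_(B' in calA) likelihood xi f B' m w))%R.
  by rewrite mulr_suml; apply: eq_bigr => B _; rewrite mulrC mulrA.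
rewrite ltr_pdivrMr//.
apply: (@lt_le_trans _ _ (c * likelihood xi f A m w)%R); last first.
  by rewrite ler_pM2l.
have -> : (c * likelihood xi f A m w =
    \sum_(B in calA) c / n * likelihood xi f A m w)%R.
  by rewrite sumr_const -[RHS]mulr_natl; field; rewrite gt_eqF.
by apply: ltr_sum => //; apply/hasP; exists A.
Qed.

Section Stage.
Variables (rho eta Q c : R).
Hypotheses (rho0 : (0 <= rho)%R) (eta0 : (0 < eta)%R) (Q0 : (0 <= Q)%R).
Hypothesis c0 : (0 < c)%R.
Hypothesis rhoP : forall A B, A != B -> (total_affinity A B <= rho)%R.
Hypothesis QP : forall A B d, A \in calA -> B \in calA -> d \in calA ->
  (W A B / W d A <= Q)%R.

(** Q bounds the ratios of losses that arise when the loss of d under A pays for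
    an obstruction raised against the decision A. *)
Definition slack : R := ((1 + n * Q) / (4 * eta))%R.

(** If W(d|A) = 0, the weight b = 1 / (2 eta) leaves P_B(E) with eta times the loss
    of d under B over c.  If W(d|A) > 0, the weight b = 2 eta W(d|A) / c leaves
    P_A(E) with eta times the loss of d under A over c, and the two factors 1 / c
    cancel in the coefficient of P_B(E). *)
Lemma unresolved_prob A B d s t E : A \in calA -> B \in calA -> d \in calA ->
  filtration xi s E ->
  P A (E `&` unresolved c A d B (s + t)) <=
  (rho ^+ t)%:E * ((eta * n * W d B / c + slack)%:E * P B E +
                   (eta * W d A / c + slack)%:E * P A E).
Proof.
move=> A_in B_in d_in sE.
have mE := filtration_measurable hxi sE.
have n0 : (0 < n)%R by rewrite ltr0n; apply/card_gt0P; exists A.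
have slack0 : (0 <= slack)%R.
  by rewrite divr_ge0// ?addr_ge0 ?mulr_ge0// ltW.
have WdB := W0 d_in B_in.
have WdA := W0 d_in A_in.
have WAB := W0 A_in B_in.
have cB0 : (0 <= eta * n * W d B / c + slack)%R.
  by rewrite addr_ge0// divr_ge0 ?mulr_ge0// ltW.
have cA0 : (0 <= eta * W d A / c + slack)%R.
  by rewrite addr_ge0// divr_ge0 ?mulr_ge0// ltW.
have rhs0 : 0 <= (rho ^+ t)%:E * ((eta * n * W d B / c + slack)%:E * P B E +
                   (eta * W d A / c + slack)%:E * P A E).
  by rewrite mule_ge0 ?lee_fin ?exprn_ge0// adde_ge0// mule_ge0// lee_fin.
(* A zero loss covers B = A, for which there is no decay. *)
have [W'0|W'0] := eqVneq (W (fallback A d) B) 0%R.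
  suff -> : P A (E `&` unresolved c A d B (s + t)) = 0 by [].
  apply/negligibleP.
    by apply: measurableI => //; exact: measurable_not_dominating.
  have nl := likelihood_eq0_negligible A (s + t).
  apply: negligibleS nl => w [_].
  rewrite /unresolved /not_dominating/= W'0 mulr0 !mul0r => le0.
  by apply/eqP; rewrite eq_le le0 likelihood_ge0.
have AB : A != B.
  by apply: contraNneq W'0 => <-; rewrite fallback_loss.
have kap0 : (0 <= n * W (fallback A d) B / c)%R.
  by rewrite divr_ge0 ?mulr_ge0// ?W0 ?fallback_mem// ltW.
have [b [b0 bA bB]] : exists b, [/\ (0 < b)%R, (b / 2 <= eta * W d A / c + slack)%R &
    ((n * W (fallback A d) B / c) / (2 * b) <= eta * n * W d B / c + slack)%R].
  rewrite /fallback; case: eqVneq => WdA0.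
    exists (1 / (2 * eta))%R; split; first by rewrite divr_gt0// mulr_gt0.
      rewrite WdA0 mulr0 mul0r add0r.
      have -> : (1 / (2 * eta) / 2 = 1 / (4 * eta))%R by field; rewrite gt_eqF.
      rewrite ler_pM2r ?invr_gt0 ?mulr_gt0//.
      by rewrite lerDl mulr_ge0.
    have -> : (n * W d B / c / (2 * (1 / (2 * eta))) = eta * n * W d B / c)%R.
      by field; rewrite !gt_eqF.
    by rewrite lerDl.
  have WdA1 : (0 < W d A)%R by rewrite lt_neqAle eq_sym WdA0.
  exists (2 * (eta * W d A / c))%R; split.
  - by rewrite mulr_gt0// divr_gt0// mulr_gt0.
  - rewrite mulrAC divff// mul1r lerDl//.
  have -> : (n * W A B / c / (2 * (2 * (eta * W d A / c))) =
      (n * (W A B / W d A)) / (4 * eta))%R.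
    by field; rewrite !gt_eqF.
  apply: (@le_trans _ _ slack); last first.
    by rewrite lerDr divr_ge0 ?mulr_ge0// ltW.
  rewrite ler_pM2r ?invr_gt0 ?mulr_gt0//.
  apply: (@le_trans _ _ (n * Q)%R); last by rewrite lerDr.
  by rewrite ler_pM2l// QP.
apply: le_trans (not_dominating_tail A B t kap0 b0 sE) _.
apply: lee_pmul.
- by rewrite lee_fin exprn_ge0//; exact: total_affinity_ge0.
- have b0' := ltW b0; have b20 : (0 <= 2 * b)%R by rewrite mulr_ge0.
  by apply: adde_ge0; apply: mule_ge0 => //; rewrite lee_fin divr_ge0.
- rewrite lee_fin lerXn2r ?nnegrE//; [exact: total_affinity_ge0|exact: rhoP].
- rewrite addeC; apply: leeD; apply: lee_wpmul2r => //; by rewrite lee_fin.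
Qed.

End Stage.

Variable delta : @procedure R K dO Omega.
Hypothesis hdelta : procedures xi calA delta.
Variable A : {set 'I_K}.
Hypothesis A_in : A \in calA.
Variable c : R.
Hypothesis c0 : (0 < c)%R.

Local Notation pairs := [seq (d, B) | d <- enum calA, B <- enum calA].

Definition late_event (s t : nat) (q : {set 'I_K} * {set 'I_K}) : set Omega :=
  stopped delta s [set q.1] `&` unresolved c A q.1 q.2 (s + t).

(** Counts the pairs of a time t and a hypothesis B that obstructs at time T + t;
    the sums over s and d only select the values of T and D. *)
Definition excess (w : Omega) : \bar R :=
  \sum_(0 <= t <oo) \sum_(0 <= s <oo) \sum_(q <- pairs) (\1_(late_event s t q) w)%:E.

Let mlate s t q : measurable (late_event s t q).
Proof.
apply: measurableI; first exact: (measurable_stopped hxi hdelta).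
exact: measurable_not_dominating.
Qed.

Let late0 s t w : 0 <= \sum_(q <- pairs) (\1_(late_event s t q) w)%:E :> \bar R.
Proof. by apply: sume_ge0 => q _; rewrite lee_fin. Qed.

Let mlate_sum s t : measurable_fun setT
  (fun w => \sum_(q <- pairs) (\1_(late_event s t q) w)%:E : \bar R).
Proof.
by apply: emeasurable_sum => q; apply/measurable_EFinP/measurable_indic/mlate.
Qed.

Let late_series0 t w :
  0 <= \sum_(0 <= s <oo) \sum_(q <- pairs) (\1_(late_event s t q) w)%:E :> \bar R.
Proof. by apply: nneseries_ge0 => s _ _; exact: late0. Qed.

Let mlate_series t : measurable_fun setT
  (fun w => \sum_(0 <= s <oo) \sum_(q <- pairs) (\1_(late_event s t q) w)%:E : \bar R).
Proof.
apply: ge0_emeasurable_sum => [s w _ _|s _]; first exact: late0.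
exact: mlate_sum.
Qed.

Lemma excess_ge0 w : 0 <= excess w.
Proof. by apply: nneseries_ge0 => t _ _; exact: late_series0. Qed.

Lemma measurable_excess : measurable_fun setT excess.
Proof.
apply: ge0_emeasurable_sum => [t w _ _|t _]; first exact: late_series0.
exact: mlate_series.
Qed.

(** Before the first t without obstruction, each of the times T, ..., T + t - 1
    adds at least 1 to the excess, while T_Ld is at most T + t. *)
Lemma T_Ld_le_excess w : T_Ld xi calA W f c w <= delta.1 w + excess w.
Proof.
have [[Tval _] Din _] := hdelta.
have [->|[s s0 Tw]] := Tval w.
  by rewrite addye ?leey// gt_eqF// (lt_le_trans _ (excess_ge0 w)).
pose late t := exists2 B, B \in calA & unresolved c A (delta.2 w) B (s + t) w.
have late1 t : late t -> (1 : \bar R) <=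
    \sum_(0 <= s <oo) \sum_(q <- pairs) (\1_(late_event s t q) w)%:E.
  move=> [B B_in UB].
  apply: (@le_trans _ _ (\sum_(q <- pairs) (\1_(late_event s t q) w)%:E)).
    rewrite (bigD1_seq (delta.2 w, B))/=; last 2 first.
    - by apply/allpairsP; exists (delta.2 w, B); rewrite !mem_enum Din.
    - apply: allpairs_uniq; rewrite ?enum_uniq// => -[? ?] [? ?] _ _ [-> ->] //.
    rewrite indicE mem_set/=; last by split.
    by rewrite leeDl// sume_ge0// => q _; rewrite lee_fin.
  rewrite (nneseriesD1 (n := s))//.
  by rewrite leeDl// nneseries_ge0// => i _ _; exact: late0.
have count N : (forall t, (t < N)%N -> late t) -> N%:R%:E <= excess w.
  move=> lateN.
  apply: (@le_trans _ _ (\sum_(0 <= t < N)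
      \sum_(0 <= s <oo) \sum_(q <- pairs) (\1_(late_event s t q) w)%:E)).
    apply: (@le_trans _ _ (\sum_(0 <= t < N) (1 : \bar R))).
      by rewrite sumEFin big_const_nat subn0 iter_addr addr0.
    rewrite !big_nat; apply: lee_sum => t /andP[_ tN]; exact/late1/lateN.
  by apply: (nneseries_lim_ge N) => t _ _; exact: late_series0.
have [late_all|] := pselect (forall t, late t).
  suff -> : excess w = +oo by rewrite Tw addey ?leey.
  apply/eqyP => r r0; apply: le_trans (count (Num.truncn r).+1 _) => //.
  by rewrite lee_fin ltW// truncnS_gt.
move=> /existsNP[t0 not_late].
have ex : exists t, `[< ~ late t >] by exists t0; apply/asboolP.
have [t /asboolP not_late_t tmin] := find_ex_minn ex.
apply: (@le_trans _ _ (s + t)%:R%:E).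
  apply: (T_Ld_le c0 A_in (Din w)) => //.
    by rewrite addn_gt0 s0.
  by move=> B B_in UB; apply: not_late_t; exists B.
rewrite Tw natrD EFinD leeD2l//; apply: count => j jt.
apply: contrapT => nj.
have /tmin : `[< ~ late j >] by apply/asboolP.
by rewrite leqNgt jt.
Qed.

Section ExcessBound.
Variables (rho eta Q L : R).
Hypotheses (rho0 : (0 < rho)%R) (rho1 : (rho < 1)%R).
Hypotheses (eta0 : (0 < eta)%R) (Q0 : (0 <= Q)%R) (L0 : (0 < L)%R).
Hypothesis rhoP : forall A B, A != B -> (total_affinity A B <= rho)%R.
Hypothesis QP : forall A B d, A \in calA -> B \in calA -> d \in calA ->
  (W A B / W d A <= Q)%R.
Hypothesis err : ERRint calA W P delta <= (L * c)%:E.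

Let C : R := slack eta Q.
Let weight1 (q : {set 'I_K} * {set 'I_K}) : R := (eta * n * W q.1 q.2 / c + C)%R.
Let weight2 (q : {set 'I_K} * {set 'I_K}) : R := (eta * W q.1 A / c + C)%R.
Let prob B d : R := fine (P B (delta.2 @^-1` [set d])).

Let C0 : (0 <= C)%R.
Proof. by rewrite divr_ge0// ?addr_ge0 ?mulr_ge0// ltW. Qed.

Let n0 : (0 < n)%R. Proof. by rewrite ltr0n; apply/card_gt0P; exists A. Qed.

Let memq q : (q \in pairs) = (q.1 \in calA) && (q.2 \in calA).
Proof.
apply/allpairsP/andP => [[[d B]] /= []|[]].
  by rewrite !mem_enum => ? ? ->.
by case: q => d B /= ? ?; exists (d, B); rewrite !mem_enum.
Qed.

Let weight1_ge0 q : q \in pairs -> (0 <= weight1 q)%R.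
Proof.
rewrite memq => /andP[? ?]; rewrite addr_ge0// divr_ge0 ?(ltW c0)//.
by rewrite !mulr_ge0 ?W0// ltW.
Qed.

Let weight2_ge0 q : q \in pairs -> (0 <= weight2 q)%R.
Proof.
rewrite memq => /andP[? ?]; rewrite addr_ge0// divr_ge0 ?(ltW c0)//.
by rewrite !mulr_ge0 ?W0// ltW.
Qed.

Let probE B d : P B (delta.2 @^-1` [set d]) = (prob B d)%:E.
Proof.
by rewrite fineK// fin_num_measure//; exact: (measurable_decision hdelta).
Qed.

Let prob_ge0 B d : (0 <= prob B d)%R. Proof. by rewrite fine_ge0. Qed.

Let sum_prob B : (\sum_(d in calA) prob B d <= 1)%R.
Proof.
rewrite -lee_fin -sumEFin.
have := sum_decision_le1 hdelta (P B).
by under eq_bigr do rewrite probE.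
Qed.

Let loss B : R := \sum_(d in calA) prob B d * W d B.

Let loss_ge0 B : B \in calA -> (0 <= loss B)%R.
Proof. by move=> ?; rewrite sumr_ge0// => d ?; rewrite mulr_ge0 ?W0. Qed.

Let sum_loss : (\sum_(B in calA) loss B <= n * (L * c))%R.
Proof.
rewrite -ler_pdivrMl// mulr_sumr -lee_fin -sumEFin; apply: le_trans err.
rewrite /ERRint le_eqVlt; apply/orP; left; apply/eqP; apply: eq_bigr => B _.
rewrite EFinM -sumEFin; congr (_ * _); apply: eq_bigr => d _.
by rewrite EFinM probE.
Qed.

Let weighted_sum :
  (\sum_(q <- pairs) (weight1 q * prob q.2 q.1 + weight2 q * prob A q.1) <=
   2 * eta * n ^+ 2 * L + 2 * C * n)%R.
Proof.
have -> : (\sum_(q <- pairs) (weight1 q * prob q.2 q.1 + weight2 q * prob A q.1) =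
    \sum_(B in calA) (eta * n / c * loss B + C * \sum_(d in calA) prob B d +
      (eta / c * loss A + C * \sum_(d in calA) prob A d)))%R.
  rewrite big_allpairs_dep big_enum/=.
  under eq_bigr do rewrite big_enum/=.
  rewrite exchange_big/=; apply: eq_bigr => B _.
  rewrite /loss !mulr_sumr -!big_split/=; apply: eq_bigr => d _.
  by rewrite /weight1 /weight2/=; ring.
have sumc (x : R) : (\sum_(B in calA) x = n * x)%R by rewrite sumr_const mulr_natl.
rewrite big_split/= big_split/= -!mulr_sumr sumc.
have S1 : (\sum_(B in calA) \sum_(d in calA) prob B d <= n)%R.
  apply: (@le_trans _ _ (\sum_(B in calA) 1)%R); first exact: ler_sum.
  by rewrite sumr_const.
have S2 : (loss A <= n * (L * c))%R.
  apply: le_trans sum_loss; rewrite (bigD1 A)//= lerDl sumr_ge0// => B /andP[? _].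
  exact: loss_ge0.
have -> : (2 * eta * n ^+ 2 * L + 2 * C * n =
    eta * n / c * (n * (L * c)) + C * n +
    n * (eta / c * (n * (L * c)) + C * 1))%R.
  by field; rewrite gt_eqF.
have enc0 : (0 <= eta * n / c)%R by rewrite divr_ge0 ?mulr_ge0// ltW.
have ec0 : (0 <= eta / c)%R by rewrite divr_ge0// ltW.
apply: lerD; first by apply: lerD; exact: ler_wpM2l.
rewrite ler_pM2l//; apply: lerD; exact: ler_wpM2l.
Qed.

(** The sums over s and over the pairs (d, B) collect the losses into the
    integrated error, which is at most L c; the sum over t is geometric. *)
Lemma integral_excess_le :
  \int[P A]_w excess w <= ((2 * eta * n ^+ 2 * L + 2 * C * n) / (1 - rho))%:E.
Proof.
rewrite integral_nneseries//.
have mS s d : measurable (stopped delta s [set d]).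
  exact: (measurable_stopped hxi hdelta).
pose G s q : \bar R := (weight1 q)%:E * P q.2 (stopped delta s [set q.1]) +
  (weight2 q)%:E * P A (stopped delta s [set q.1]).
have G0 s q : q \in pairs -> 0 <= G s q.
  move=> qp; apply: adde_ge0; apply: mule_ge0 => //; rewrite lee_fin.
  - exact: weight1_ge0.
  - exact: weight2_ge0.
have sumG : \sum_(0 <= s <oo) \sum_(q <- pairs) G s q <=
    (2 * eta * n ^+ 2 * L + 2 * C * n)%:E.
  under eq_eseriesr do rewrite big_seq.
  rewrite nneseries_sum; last by move=> q s qp; exact: G0.
  rewrite -big_seq.
  apply: (@le_trans _ _ (\sum_(q <- pairs)
      (weight1 q * prob q.2 q.1 + weight2 q * prob A q.1)%:E)); last first.
    by rewrite sumEFin lee_fin; exact: weighted_sum.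
  rewrite big_seq [leRHS]big_seq; apply: lee_sum => q qp.
  rewrite nneseriesD; last 2 first.
  - by move=> s _ _; rewrite mule_ge0// lee_fin weight1_ge0.
  - by move=> s _ _; rewrite mule_ge0// lee_fin weight2_ge0.
  have -> : (weight1 q * prob q.2 q.1 + weight2 q * prob A q.1)%:E =
      (weight1 q)%:E * P q.2 (delta.2 @^-1` [set q.1]) +
      (weight2 q)%:E * P A (delta.2 @^-1` [set q.1]) by rewrite !probE.
  rewrite !nneseriesZl//; apply: leeD.
  - apply: lee_wpmul2l; first by rewrite lee_fin weight1_ge0.
    exact: (sum_stopped_le hxi hdelta).
  - apply: lee_wpmul2l; first by rewrite lee_fin weight2_ge0.
    exact: (sum_stopped_le hxi hdelta).
have step t : \int[P A]_w
      (\sum_(0 <= s <oo) \sum_(q <- pairs) (\1_(late_event s t q) w)%:E) <=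
    (rho ^+ t * (2 * eta * n ^+ 2 * L + 2 * C * n))%:E.
  rewrite integral_nneseries//.
  apply: (@le_trans _ _ (\sum_(0 <= s <oo) (rho ^+ t)%:E * \sum_(q <- pairs) G s q)).
    apply: lee_nneseries => [s _ _|s _]; first by apply: integral_ge0.
    rewrite ge0_integral_sum//; last first.
      by move=> q; apply/measurable_EFinP/measurable_indic.
    rewrite big_seq [X in _ <= _ * X]big_seq ge0_sume_distrr//; last first.
      by move=> q qp; exact: G0.
    apply: lee_sum => q qp; rewrite integral_indic// setIT.
    move: (qp); rewrite memq => /andP[d_in B_in].
    apply: (unresolved_prob (ltW rho0) eta0 Q0 c0 rhoP QP) => //.
    exact: (filtration_stopped hdelta).
  rewrite nneseriesZl; last first.
    by move=> s _; rewrite big_seq sume_ge0// => q qp; exact: G0.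
  by rewrite EFinM; apply: lee_wpmul2l => //; rewrite lee_fin exprn_ge0// ltW.
set H := (2 * eta * n ^+ 2 * L + 2 * C * n)%R in step *.
have H0 : (0 <= H)%R.
  have eta0' := ltW eta0; have L0' := ltW L0; have n0' := ltW n0.
  apply: addr_ge0; first by rewrite !mulr_ge0 ?exprn_ge0.
  by apply: mulr_ge0 => //; exact: mulr_ge0.
apply: lime_le.
  apply: is_cvg_nneseries => t _ _; apply: integral_ge0 => w _; exact: late_series0.
apply: nearW => N.
apply: (@le_trans _ _ (\sum_(0 <= t < N) (rho ^+ t * H)%:E)).
  by apply: lee_sum => t _; exact: step.
rewrite sumEFin lee_fin.
have geo := @geometric_le_lim R N H rho H0 rho0.
rewrite (ger0_norm (ltW rho0)) in geo; apply: le_trans (geo rho1).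
rewrite le_eqVlt; apply/orP; left; apply/eqP; apply: eq_bigr => t _.
by rewrite /geometric/= mulrC.
Qed.

End ExcessBound.

End Model.

Theorem theorem1 (R : realType) (K : nat) (hK : (2 <= K)%N)
    (dX : 'I_K -> measure_display) (X : forall k, measurableType (dX k))
    (mu : forall k, {sigma_finite_measure set (X k) -> \bar R})
    (f : bool -> forall k, X k -> R)
    (hf : forall b k, is_density (mu k) (f b k))
    (dO : measure_display) (Omega : measurableType dO)
    (xi : forall k : 'I_K, nat -> Omega -> X k)
    (hxi : forall k s, measurable_fun setT (xi k s))
    (P : {set 'I_K} -> probability Omega R)
    (hP : forall A, stream_law mu f xi A (P A))
    (calA : {set {set 'I_K}})
    (hmean : forall k i, 0 < log_ratio_mean (mu k) (f i k) (f (~~ i) k))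
    (hmoment2 : forall k i, log_ratio_moment2 (mu k) (f i k) (f (~~ i) k) < +oo)
    (W : {set 'I_K} -> {set 'I_K} -> R)
    (hW : is_loss calA W)
    (hWpos : forall D, D \in calA -> (0 < \big[Num.max/0]_(A in calA) W D A)%R) :
  exists2 M : R, (0 < M)%R &
    forall (r : nat) (hr : r = 1%N \/ r = 2%N)
      (Delta : 'rV[R]_r -> set (@procedure R K dO Omega))
      (delta0 : 'rV[R]_r -> @procedure R K dO Omega)
      (c : 'rV[R]_r -> R) (L : R),
      (forall theta, open_unit_cube r theta ->
         Delta theta `<=` procedures xi calA) ->
      (forall theta, open_unit_cube r theta -> Delta theta (delta0 theta)) ->
      (forall theta, open_unit_cube r theta -> (0 < c theta)%R) ->
      (0 < L)%R ->
      (forall A theta, A \in calA -> open_unit_cube r theta ->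
         {ae P A, forall w,
            (delta0 theta).1 w <= T_Ld xi calA W f (c theta) w}) ->
      (forall theta delta, open_unit_cube r theta -> Delta theta delta ->
         ERRint calA W P delta <= (L * c theta)%:E) ->
      forall A theta, A \in calA -> open_unit_cube r theta ->
        expected_time (P A) (delta0 theta).1 - Tmin (P A) (Delta theta)
          <= ((2 * L + M) * #|calA|%:R)%:E.
Proof.
have [rho [rho0 rho1 rhoP]] := exists_affinity_bound hf hmean.
pose n : R := #|calA|%:R.
pose Q : R := \big[Num.max/0%R]_(q : {set 'I_K} * {set 'I_K} * {set 'I_K})
  (W q.1.1 q.1.2 / W q.2 q.1.1)%R.
have Q0 : (0 <= Q)%R by exact: bigmax_ge_id.
have QP A B d : A \in calA -> B \in calA -> d \in calA -> (W A B / W d A <= Q)%R.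
  by move=> _ _ _; exact: (le_bigmax _ _ (A, B, d)).
(* This eta turns 2 eta n^2 L / (1 - rho) into 2 L n. *)
pose eta : R := ((1 - rho) / n)%R.
pose C : R := slack calA eta Q.
have r1 : (0 < 1 - rho)%R by rewrite subr_gt0.
have C0 : (0 <= C)%R.
  have n0 : (0 <= n)%R by rewrite ler0n.
  have eta0 : (0 <= eta)%R by apply: divr_ge0 => //; exact: ltW.
  by apply: divr_ge0; [apply: addr_ge0 => //; exact: mulr_ge0|exact: mulr_ge0].
exists (2 * C / (1 - rho) + 1)%R.
  by rewrite ltr_wpDl//; apply: divr_ge0; [exact: mulr_ge0|exact: ltW].
move=> r _ Delta delta0 c L hDelta hdelta0 hc L0 hT hErr A theta A_in th.
have n0 : (0 < n)%R by rewrite ltr0n; apply/card_gt0P; exists A.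
have eta0 : (0 < eta)%R by rewrite divr_gt0.
have c0 := hc theta th.
have pd0 := hDelta theta th _ (hdelta0 theta th).
set M := (2 * C / (1 - rho) + 1)%R; set b := ((2 * L + M) * _)%R.
have key delta : Delta theta delta ->
    expected_time (P A) (delta0 theta).1 <= expected_time (P A) delta.1 + b%:E.
  move=> Dd; have pd := hDelta theta th _ Dd.
  have ex0 := excess_ge0 f xi calA W delta A (c theta).
  have mex := measurable_excess hf hxi W pd A (c theta).
  have mT := measurable_stopping_time hxi pd.
  have T0 := stopping_time_ge0 pd.
  apply: (@le_trans _ _ (\int[P A]_w
      (delta.1 w + excess f xi calA W delta A (c theta) w))).
    apply: ae_ge0_le_integral => //.
    - by move=> w _; exact: (stopping_time_ge0 pd0).
    - exact: (measurable_stopping_time hxi pd0).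
    - by move=> w _; exact: adde_ge0.
    - exact: emeasurable_funD.
    move: (hT A theta A_in th); apply: filterS => w le _.
    exact: le_trans le (T_Ld_le_excess hf hW pd A_in c0 w).
  rewrite ge0_integralD//; apply: leeD => //.
  apply: le_trans (integral_excess_le hf hxi hP hW pd A_in c0
    rho0 rho1 eta0 Q0 L0 rhoP QP (hErr theta _ th Dd)) _.
  rewrite lee_fin -/C -/n /b /M.
  have -> : ((2 * eta * n ^+ 2 * L + 2 * C * n) / (1 - rho) =
      (2 * L + 2 * C / (1 - rho)) * n)%R.
    by rewrite /eta; field; rewrite !gt_eqF.
  by rewrite ler_pM2r// lerD2l lerDl.
have Tmin0 : 0 <= Tmin (P A) (Delta theta).
  apply: le_ereal_inf_tmp => _ [delta Dd <-]; apply: integral_ge0 => w _.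
  exact: (stopping_time_ge0 (hDelta theta th _ Dd)).
(* An infinite optimum makes the difference -oo. *)
have [->|Tfin] := eqVneq (Tmin (P A) (Delta theta)) +oo.
  by rewrite /= addeNy// leNye.
have Tfin' : Tmin (P A) (Delta theta) \is a fin_num.
  by rewrite ge0_fin_numE// lt_neqAle Tfin leey.
rewrite leeBlDr// addeC -leeBlDr//; apply: le_ereal_inf_tmp => _ [delta Dd <-].
by rewrite leeBlDr//; exact: key.
Qed.
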